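(* Let $p=p_n\in(0,1)$ be a sequence with $p_n\to0$ as $n\to\infty$, let $q=q_n=1-p_n$, and let $X_n=X_n(p_n)$ be the number of correct guesses under the optimal strategy in the complete feedback game after one asymmetric single-shelf shuffle of $n$ cards with parameter $p_n$. (1) If $\frac1n\ll p\ll\frac{\ln n-\ln\ln n}{n}$, then $\frac{X_n-nq}{\sqrt{npq}}$ converges in distribution to a standard normal random variable. (2) If $p\ll\frac1n$, then $X_n/n\to1$ in probability. (3) If $p\gg\frac{\ln n-\ln\ln n}{n}$, then $(X_n-\mathbb{E}(X_n))/\sqrt{\mathrm{Var}(X_n)}$ converges in distribution to a standard normal random variable.
   Context: For sequences, $a_n\ll b_n$ (equivalently $b_n\gg a_n$) means $a_n/b_n\to0$ as $n\to\infty$. Asymmetric single-shelf shuffle with parameter $p\in(0,1)$: start with an ordered deck of $n$ cards labelled $1,\dots,n$ (card $1$ on top). Cards are drawn one at a time from the bottom of the deck (card $n$ first, card $1$ last) and placed in a pile; independently, each drawn card is placed at the top of the pile with probability $p$ and at the bottom with probability $1-p$. Equivalently, let $\varepsilon_1,\dots,\varepsilon_{n-1}$ be independent Bernoulli$(p)$ ($\varepsilon_j=1$ iff card $j$ is placed at the top); the shuffled deck read from the top consists of the cards $j\le n-1$ with $\varepsilon_j=1$ in increasing order, then card $n$, then the cards with $\varepsilon_j=0$ in decreasing order. Complete feedback game: the player guesses the cards of the shuffled deck sequentially from the top; after each guess the card is shown and removed. Let $\nu=1$ if $p\ge\frac12$ and $\nu=\lfloor \log p/\log(1-p)\rfloor+1$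 if $0<p<\frac12$. Optimal strategy used: let $j$ be the label of the last card shown ($j=0$ before the first guess). As long as neither card $n$ nor card $n-1$ has been shown: if $p\ge\frac12$, guess $j+1$; if $p<\frac12$, guess $n$ when $n-j\le\nu$ and guess $j+1$ when $n-j>\nu$. Once card $n$ or $n-1$ has been shown, guess the remaining cards in decreasing order. $X_n(p)$ denotes the number of correct guesses under this strategy. *)

(* Defs.v *)
From HB Require Import structures.
From mathcomp Require Import all_boot all_order all_algebra.
From mathcomp Require Import all_classical all_reals all_analysis.

Set Implicit Arguments.
Unset Strict Implicit.
Unset Printing Implicit Defensive.

Import Order.TTheory GRing.Theory Num.Theory.
Import numFieldNormedType.Exports.

Local Open Scope classical_set_scope.
Local Open Scope ring_scope.

Definition much_less (R : realType) (a b : nat -> R) : Prop :=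
  a n / b n @[n --> \oo] --> 0.

(* [A i = setT] is allowed, so the product rule for subfamilies is included. *)
Definition independent_RVs d d' (T : measurableType d) (T' : measurableType d')
    (R : realType) (P : probability T R) (I : finType)
    (X : I -> {RV P >-> T'}) : Prop :=
  forall A : I -> set T', (forall i, measurable (A i)) ->
    P (\bigcap_i (X i @^-1` A i)) = (\prod_i P (X i @^-1` A i))%E.

Definition iid_bernoulli d (T : measurableType d) (R : realType)
    (P : probability T R) (p : R) (I : finType)
    (eps : I -> {RV P >-> bool}) : Prop :=
  independent_RVs eps /\
  forall i (A : set bool), distribution P (eps i) A = bernoulli_prob p A.

Definition cvg_in_distribution (R : realType) (d : nat -> measure_display)
    (T : forall n, measurableType (d n)) (P : forall n, probability (T n) R)
    (X : forall n, {RV (P n) >-> R})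
    (mu : probability (measurableTypeR R) R) : Prop :=
  forall x : R, {for x, continuous (fun y : R => mu [set` `]-oo, y]])} ->
    cdf (X n) x @[n --> \oo] --> mu [set` `]-oo, x]].

Definition cvg_in_probability (R : realType) (d : nat -> measure_display)
    (T : forall n, measurableType (d n)) (P : forall n, probability (T n) R)
    (X : forall n, T n -> R) (l : R) : Prop :=
  forall e : R, 0 < e ->
    P n [set w | e < `|X n w - l|] @[n --> \oo] --> 0%E.

(* Decks are listed from the top. Index [i : 'I_n] stands for card [i.+1], and
   [e i] says that this card goes to the top of the pile; [foldr] handles card
   [n] first and card [1] last. The value of [e] at card [n], which is placed on
   an empty pile, is immaterial. *)
Definition shelf_shuffle (n : nat) (e : 'I_n -> bool) : seq nat :=
  foldr (fun (i : 'I_n) pile => if e i then i.+1 :: pile else rcons pile i.+1)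
    [::] (enum 'I_n).

Definition nu (R : realType) (p : R) : int :=
  if 2^-1 <= p then 1 else Num.floor (ln p / ln (1 - p)) + 1.

(* [shown] lists the cards shown so far, in chronological order. *)
Definition guess (R : realType) (p : R) (n : nat) (shown : seq nat) : nat :=
  if (n \in shown) || (n.-1 \in shown) then
    (\max_(k <- iota 1 n | k \notin shown) k)%N
  else
    let j := last 0%N shown in
    if (p < 2^-1) && (n%:Z - j%:Z <= nu p) then n else j.+1.

Definition correct_guesses (R : realType) (p : R) (n : nat) (deck : seq nat) :
    nat :=
  (\sum_(i < size deck) (guess p n (take i deck) == nth 0 deck i))%N.

Section num_correct.
Context d (T : measurableType d) (R : realType) (P : probability T R).
Variables (p : R) (n : nat) (eps : 'I_n -> {RV P >-> bool}).

Definition num_correct : T -> R := fun w =>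
  (correct_guesses p n (shelf_shuffle (fun i => eps i w)))%:R.

Let measurable_num_correct : measurable_fun [set: T] num_correct.
Proof.
pose f (v : {ffun 'I_n -> bool}) : R :=
  (correct_guesses p n (shelf_shuffle v))%:R.
pose E (v : {ffun 'I_n -> bool}) : set T :=
  \bigcap_i (eps i @^-1` [set v i]).
have EP w : E [ffun i => eps i w] w by move=> i _; rewrite /= ffunE.
move=> _ B _; rewrite setTI.
have -> : num_correct @^-1` B = \bigcup_(v in [set v | B (f v)]) E v.
  have fE v w : E v w -> f v = num_correct w.
    move=> Evw; rewrite /f /num_correct.
    by have -> : (v : 'I_n -> bool) = (fun i => eps i w)
      by apply/funext => i; rewrite (Evw i).
  apply/seteqP; split => [w Bw|w [v /= Bv /fE vE]]; last by rewrite /= -vE.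
  by exists [ffun i => eps i w]; [rewrite /= (fE _ w (EP w))|exact: EP].
apply: fin_bigcup_measurable => [|v _]; first exact: finite_finset.
by apply: fin_bigcap_measurable => // i _; exact: measurable_funPTI.
Qed.

HB.instance Definition _ :=
  isMeasurableFun.Build _ _ _ _ num_correct measurable_num_correct.

Definition num_correct_RV : {RV P >-> R} := num_correct.

End num_correct.

Section standardize.
Context d (T : measurableType d) (R : realType) (P : probability T R).
Variables (X : {RV P >-> R}) (m s : R).

Definition standardize : T -> R := fun w => (X w - m) / s.

Let measurable_standardize : measurable_fun [set: T] standardize.
Proof.
by apply: measurable_realfun.measurable_funM => //;
   exact: measurable_realfun.measurable_funB.
Qed.

HB.instance Definition _ :=
  isMeasurableFun.Build _ _ _ _ standardize measurable_standardize.

Definition standardize_RV : {RV P >-> R} := standardize.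

End standardize.

(* Main.v *)
From HB Require Import structures.
Require Import Defs.
From mathcomp Require Import all_boot all_order all_algebra.
From mathcomp Require Import all_classical all_reals all_analysis.
From mathcomp Require Import ring lra zify.

Set Implicit Arguments.
Unset Strict Implicit.
Unset Printing Implicit Defensive.

Import Order.TTheory GRing.Theory Num.Theory.
Import numFieldNormedType.Exports.

Local Open Scope classical_set_scope.
Local Open Scope ring_scope.

(** Write e_j = 1 when card j goes to the top of the pile, and let B be the
    number of zeros among the n bits. Cards placed at the bottom come out after
    card n, hence while the remaining cards are guessed in decreasing order, and
    every one of them is guessed. A card placed at the top, the first one aside,
    is guessed only if it is the successor of the card shown before it, which
    needs two consecutive ones.
    So the score is X = B + Y + O(1), where Y counts the k with e_k = e_(k+1) = 1
    that satisfy a condition on k alone, fixed by n and p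
    ([correct_guesses_approx]).

    The correction Y is small because p is: its mean is at most n p^2 and its
    variance at most 3 n p^2 ([mean_pairs_le], [fin_variance_pairs_le]), whereas
    B has variance s^2 = n p q. The three claims follow.
    - If p is much smaller than (ln n - ln ln n) / n then n p^2 <= 4 eventually,
      so X differs from B by O(1) in mean, and dividing by s, which tends to
      infinity as n p does, makes the difference vanish ([clt_sparse]).
    - If p is much larger than that then n p tends to infinity, and after
      centring X and B at their means the difference has variance
      O(n p^2 + 1) = o(s^2); the standard deviations of X and B are then
      equivalent too ([kolmogorov_standardized], [clt_dense]).
    - E |X - n| <= n p + n p^2 + 2, and Markov's inequality gives the weak law
      ([weak_law]).

    Asymptotic normality of B when s tends to infinity is proved by Stein's
    method, with an error of order 1 / s. With W = (B - n q) / s, flipping one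
    bit gives an exact identity ([stein_identity]), which in terms of W reads
    E [s (g (W + 1/s) - g W) - W g W - q W (g (W + 1/s) - g W)] = 0. Its first
    two terms are a discrete form of g' - x g, so it remains to solve
    g' - x g = f - E f(N), N standard normal, with g regular, for a class of
    functions f from which distribution functions can be recovered. Taking f to
    be a function k of Phi makes this explicit, since Phi (N) is uniform:
    g = K (Phi) / phi, with K vanishing at 0 and 1 and K' = k - int_0^1 k. The
    choice k (u) = max (0, s - u) suffices: difference quotients in s of these
    ramps squeeze the indicator of u <= Phi a ([kolmogorov_of_ramp]). The ramps
    are Lipschitz, so replacing W by a variable close to it in mean costs
    nothing more ([kolmogorov_near_binomial]).

    Everything random is a function of finitely many independent bits, so
    expectations are finite sums over the cube of bit vectors
    ([integral_outcome]). *)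

(** * The standard normal law and its Stein equation *)

Section normal.
Context {R : realType}.
Implicit Types x y : R.

Local Notation phi := (@normal_pdf R 0 1).

Definition Phi x : R := fine (normal_prob 0 1 `]-oo, x]).

Lemma normal_pdf01E x : phi x = normal_peak 1 * expR (- (x ^+ 2) / 2).
Proof.
by rewrite normal_pdfE ?oner_neq0// /normal_fun subr0 expr1n.
Qed.

Lemma phi_gt0 x : 0 < phi x.
Proof. by rewrite normal_pdf01E mulr_gt0 ?expR_gt0 ?normal_peak_gt0 ?oner_neq0. Qed.

Lemma phi_le x : phi x <= normal_peak 1.
Proof. exact: normal_pdf_ub (oner_neq0 _). Qed.

Lemma is_derive_phi x : is_derive x 1 phi (- x * phi x).
Proof.
have -> : phi = (fun x => normal_peak 1 * expR (- (x ^+ 2) / 2)).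
  by apply/funext => y; exact: normal_pdf01E.
by apply: is_derive_eq; rewrite /GRing.scale/=; field.
Qed.

Lemma is_derive_Phi x : is_derive x 1 Phi (phi x).
Proof.
have i : lebesgue_measure.-integrable `]-oo, (x + 1)] (EFin \o phi).
  apply: (integrableS _ _ (subsetT _)) => //; exact: integrable_normal_pdf.
have c : {for x, continuous phi} by apply: continuous_normal_pdf; exact: oner_neq0.
have xx1 : x < x + 1 by rewrite ltrDl.
have [dP P'] := @continuous_FTC1 R phi (BInfty _ true) x (x + 1) xx1 i (ltNyr _) c.
by split => //; rewrite -P' derive1E.
Qed.

Lemma PhiE x : (Phi x)%:E = normal_prob 0 1 `]-oo, x].
Proof. by rewrite /Phi fineK// fin_num_measure. Qed.

Lemma Phi_01 x : 0 <= Phi x <= 1.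
Proof.
by rewrite -!lee_fin PhiE measure_ge0 probability_le1.
Qed.

(* The identity has law [normal_prob 0 1], so Phi is its [cdf]. *)
Let id_RV : measurableTypeR R -> R := idfun.
#[local] HB.instance Definition _ :=
  @isMeasurableFun.Build _ _ _ _ id_RV (@measurable_id _ _ setT).

Lemma cvg_PhiNy : Phi x @[x --> -oo] --> (0 : R).
Proof. exact: fine_cvg (cvg_cdfNy0 (id_RV : {RV (normal_prob 0 1) >-> R})). Qed.

Lemma cvg_Phiy : Phi x @[x --> +oo] --> (1 : R).
Proof. exact: fine_cvg (cvg_cdfy1 (id_RV : {RV (normal_prob 0 1) >-> R})). Qed.

Lemma mvt_le (f df : R -> R) : (forall x, is_derive x 1 f (df x)) ->
  forall x y, x <= y -> exists2 c, x <= c <= y & f y - f x = df c * (y - x).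
Proof.
move=> dfE x y; rewrite le_eqVlt => /predU1P[<-|xy].
  by exists x; rewrite ?lexx// !subrr mulr0.
have fc z : {for z, continuous f}.
  by apply: differentiable_continuous; apply/derivable1_diffP; exact: @ex_derive.
have fw : {within `[x, y], continuous f}.
  by apply: continuous_subspaceT; exact: fc.
have [c + E] := @MVT R f df _ _ xy (fun z _ => dfE z) fw.
by rewrite in_itv/= => /andP[xc cy]; exists c; rewrite // !ltW.
Qed.

Lemma mvt_dist (f df : R -> R) : (forall x, is_derive x 1 f (df x)) ->
  forall x y, exists2 c, `|c - x| <= `|y - x| & f y - f x = df c * (y - x).
Proof.
move=> dfE x y; have [xy|/ltW yx] := leP x y.
  have [c /andP[xc cy] E] := mvt_le dfE xy; exists c => //.
  by rewrite !ger0_norm ?subr_ge0// lerD2r.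
have [c /andP[yc cx] E] := mvt_le dfE yx; exists c.
  by rewrite !ler0_norm ?subr_le0// lerN2 lerD2r.
by rewrite -(opprB (f x)) E -mulrN opprB.
Qed.

Lemma derive_ge0_le (f df : R -> R) x y : (forall x, is_derive x 1 f (df x)) ->
  x <= y -> (forall c, x <= c <= y -> 0 <= df c) -> f x <= f y.
Proof.
move=> dfE xy df0; have [c cxy E] := mvt_le dfE xy.
by rewrite -subr_ge0 E mulr_ge0 ?df0// subr_ge0.
Qed.

Lemma derive_norm_le (f df : R -> R) M : (forall x, is_derive x 1 f (df x)) ->
  (forall x, `|df x| <= M) -> forall x y, `|f y - f x| <= M * `|y - x|.
Proof.
move=> dfE dfM x y; have [c _ ->] := mvt_dist dfE x y.
by rewrite normrM ler_wpM2r.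
Qed.

(** Reduces the differentiability of the square of a positive part, whose second
    derivative jumps at 0, to polynomial inequalities. *)
Lemma is_derive_quadratic (f : R -> R) x a :
  (forall y, `|f y - f x - a * (y - x)| <= (y - x) ^+ 2) -> is_derive x 1 f a.
Proof.
move=> fE.
have lim : h^-1 *: (f (h *: (1 : R) + x) - f x) @[h --> 0^'] --> a.
  apply/cvgrPdist_le => e e0; near=> h.
  have h0 : h != 0 by near: h; exact: nbhs_dnbhs_neq.
  rewrite /GRing.scale/= mulr1 -(@ler_pM2l _ `|h|) ?normr_gt0// -normrM.
  rewrite mulrBr mulrA divff// mul1r distrC.
  have := fE (h + x); rewrite addrK [h * a]mulrC => /le_trans; apply.
  rewrite -real_normK ?num_real// expr2 ler_wpM2l//.
  near: h; apply: dnbhs0_le => //.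
apply: DeriveDef; first by apply/cvg_ex; exists a.
by apply/cvg_lim => //; exact: Rhausdorff.
Unshelve. all: by end_near. Qed.

Lemma is_derive_sqr_pos x :
  is_derive x 1 (fun x => Num.max 0 x ^+ 2) (2 * Num.max 0 x).
Proof.
apply: is_derive_quadratic => y; rewrite ler_norml.
have := sqr_ge0 (y - x); have := sqr_ge0 (y + x); have := sqr_ge0 y.
by case: (leP 0 x) => x0; case: (leP 0 y) => y0 *; apply/andP; split; nra.
Qed.

Lemma Phi_nondecreasing : {homo Phi : x y / x <= y}.
Proof.
move=> x y xy; apply: (derive_ge0_le is_derive_Phi xy) => c _.
exact: normal_pdf_ge0.
Qed.

Lemma Phi_lipschitz x y : `|Phi y - Phi x| <= normal_peak 1 * `|y - x|.
Proof.
apply: (derive_norm_le is_derive_Phi) => z.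
by rewrite ger0_norm ?normal_pdf_ge0// phi_le.
Qed.

(** For fixed x the function t |-> x Phi t + phi t has derivative (x - t) phi t,
    so it increases up to t = x, and it is at least x Phi t, which tends to 0 at
    -oo. Keeping x fixed avoids dividing by t. *)
Lemma mills_left x : x <= 0 -> - x * Phi x <= phi x.
Proof.
move=> x0; rewrite mulNr lerNl -subr_ge0 opprK.
have d y : is_derive y 1 (fun t => x * Phi t + phi t) ((x - y) * phi y).
  have dP := is_derive_Phi y; have dp := is_derive_phi y.
  by apply: is_derive_eq; rewrite /GRing.scale/=; ring.
have le y : y <= x -> x * Phi y <= x * Phi x + phi x.
  move=> yx; apply: (@le_trans _ _ (x * Phi y + phi y)).
    by rewrite lerDl normal_pdf_ge0.
  apply: (derive_ge0_le d yx) => c /andP[_ cx].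
  by rewrite mulr_ge0 ?subr_ge0// normal_pdf_ge0.
have l : x * Phi y @[y --> -oo] --> x * 0.
  by apply: cvgM; [exact: cvg_cst|exact: cvg_PhiNy].
rewrite mulr0 in l; apply: (cvgr_to_le l); near=> y.
by apply: le; near: y; apply: nbhs_ninfty_le; rewrite num_real.
Unshelve. all: by end_near. Qed.

(** The mirror image of [mills_left], from the limit of Phi at +oo. *)
Lemma mills_right x : 0 <= x -> x * (1 - Phi x) <= phi x.
Proof.
move=> x0; rewrite -subr_ge0.
have d y : is_derive y 1 (fun t => x * (1 - Phi t) - phi t) ((y - x) * phi y).
  have dP := is_derive_Phi y; have dp := is_derive_phi y.
  by apply: is_derive_eq; rewrite /GRing.scale/=; ring.
have le y : x <= y -> - (x * (1 - Phi y)) <= phi x - x * (1 - Phi x).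
  move=> xy; rewrite -[leRHS]opprB lerN2.
  apply: (@le_trans _ _ (x * (1 - Phi y) - phi y)).
    apply: (derive_ge0_le d xy) => c /andP[xc _].
    by rewrite mulr_ge0 ?subr_ge0// normal_pdf_ge0.
  by rewrite gerBl normal_pdf_ge0.
have l : - (x * (1 - Phi y)) @[y --> +oo] --> - (x * (1 - 1)).
  apply: cvgN; apply: cvgM; first exact: cvg_cst.
  by apply: cvgB; [exact: cvg_cst|exact: cvg_Phiy].
rewrite subrr mulr0 oppr0 in l; apply: (cvgr_to_le l); near=> y.
by apply: le; near: y; apply: nbhs_pinfty_ge; rewrite num_real.
Unshelve. all: by end_near. Qed.

Lemma max0_lipschitz x y : `|Num.max 0 x - Num.max 0 y| <= `|x - y|.
Proof.
have := ler_norm (x - y); have := ler_norm (y - x); rewrite distrC ler_norml.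
by case: (leP 0 x) => x0; case: (leP 0 y) => y0 *; apply/andP; split; lra.
Qed.

(** For s in the unit interval, the primitive vanishing at 0 and 1 of
    u |-> max (0, s - u) - s^2 / 2; the subtracted constant is the mean of the
    ramp over the unit interval. *)
Definition stein_num (s u : R) : R :=
  (s ^+ 2 - Num.max 0 (s - u) ^+ 2) / 2 - s ^+ 2 / 2 * u.

(** These are the bounds that Mills' inequalities turn into bounds on the Stein
    solution: the numerator is dominated by both tails of the normal law. *)
Lemma stein_num_bounds s u : 0 <= s <= 1 -> 0 <= u <= 1 ->
  [/\ 0 <= stein_num s u, stein_num s u <= u & stein_num s u <= 1 - u].
Proof.
move=> /andP[s0 s1] /andP[u0 u1]; rewrite /stein_num !expr2.
have s1' : 0 <= 1 - s by rewrite subr_ge0.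
have u1' : 0 <= 1 - u by rewrite subr_ge0.
have h1 := mulr_ge0 s0 s1'; have h2 := mulr_ge0 u0 s1'.
have h3 := mulr_ge0 u0 h1; have h4 := mulr_ge0 u0 (mulr_ge0 s0 s0).
have h5 := mulr_ge0 u0 (mulr_ge0 s1' s1'); have h6 := mulr_ge0 u1' u1'.
have h7 := mulr_ge0 u0 u0; have h8 := mulr_ge0 u1' (mulr_ge0 s0 s0).
have h9 := mulr_ge0 u1' h1; have h10 := mulr_ge0 u1' s1'.
case: (leP 0 (s - u)) => su; last by split; nra.
by have h11 := mulr_ge0 u0 su; split; nra.
Qed.

(** The bounded solution g of g' - x g = max (0, s - Phi x) - s^2 / 2. *)
Definition stein_sol (s x : R) : R := stein_num s (Phi x) / phi x.

Lemma stein_sol_ge0 s x : 0 <= s <= 1 -> 0 <= stein_sol s x.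
Proof.
move=> s01; have [K0 _ _] := stein_num_bounds s01 (Phi_01 x).
by rewrite divr_ge0// normal_pdf_ge0.
Qed.

(** Bounding x g is the only point where the decay of the normal tails enters;
    the Lipschitz bound on g follows from it by the Stein equation. *)
Lemma stein_sol_mul_le1 s x : 0 <= s <= 1 -> `|x * stein_sol s x| <= 1.
Proof.
move=> s01; have [K0 Ku K1u] := stein_num_bounds s01 (Phi_01 x).
rewrite normrM (ger0_norm (stein_sol_ge0 _ s01)) mulrA ler_pdivrMr ?phi_gt0// mul1r.
have [x0|x0] := leP 0 x.
  by apply: le_trans (mills_right x0); rewrite ger0_norm// ler_wpM2l.
apply: le_trans (mills_left (ltW x0)).
by rewrite ltr0_norm// ler_wpM2l// oppr_ge0 ltW.
Qed.

Lemma is_derive_stein_sol s x : is_derive x 1 (stein_sol s)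
  (Num.max 0 (s - Phi x) - s ^+ 2 / 2 + x * stein_sol s x).
Proof.
have dP := is_derive_Phi x; have dp := is_derive_phi x.
have d1 : is_derive x 1 (fun x => s - Phi x) (- phi x).
  by apply: is_derive_eq; rewrite /GRing.scale/=; ring.
have d2 := is_derive_sqr_pos (s - Phi x).
have d3 : is_derive x 1 (fun x => Num.max 0 (s - Phi x) ^+ 2)
   (2 * Num.max 0 (s - Phi x) * - phi x).
  have := @is_derive1_comp R (fun x => Num.max 0 x ^+ 2) (fun x => s - Phi x) x _ _ d2 d1.
  exact.
have p0 : phi x != 0 by rewrite gt_eqF ?phi_gt0.
have d4 : is_derive x 1 (fun x => (phi x)^-1) (x / phi x).
  apply: is_derive_eq (is_deriveV p0 dp) _.
  by rewrite /GRing.scale/=; field.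
have d5 : is_derive x 1 (fun x => stein_num s (Phi x))
   ((Num.max 0 (s - Phi x) - s ^+ 2 / 2) * phi x).
  rewrite /stein_num; apply: is_derive_eq.
  by rewrite /GRing.scale/=; field.
rewrite /stein_sol; apply: is_derive_eq (is_deriveM d5 d4) _.
by rewrite /GRing.scale/=; field.
Qed.

Lemma stein_sol_lipschitz s x y : 0 <= s <= 1 ->
  `|stein_sol s y - stein_sol s x| <= 2 * `|y - x|.
Proof.
move=> s01; apply: (derive_norm_le (is_derive_stein_sol s)) => z.
rewrite -[leRHS]/(1 + 1) (le_trans (ler_normD _ _))// lerD ?stein_sol_mul_le1//.
have /andP[u0 u1] := Phi_01 z; case/andP: s01 => s0 s1.
have h1 := mulr_ge0 s0 s0; have h2 : s * s <= 1 by nra.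
by rewrite ler_norml expr2; case: (leP 0 (s - Phi z)) => su; apply/andP; split; lra.
Qed.

Lemma stein_sol_le s x : 0 <= s <= 1 ->
  `|stein_sol s x| <= (normal_peak 1)^-1 + 2 * `|x|.
Proof.
move=> s01; rewrite -[stein_sol s x](subrK (stein_sol s 0)).
rewrite addrC (le_trans (ler_normD _ _))// lerD//; last first.
  by rewrite (le_trans (stein_sol_lipschitz _ _ s01))// subr0.
rewrite ger0_norm ?stein_sol_ge0// /stein_sol normal_pdf01E.
have -> : expR (- 0 ^+ 2 / 2) = 1 :> R by rewrite expr0n/= oppr0 mul0r expR0.
have [_ K1 _] := stein_num_bounds s01 (Phi_01 0).
rewrite mulr1 -[leRHS]mul1r ler_wpM2r ?invr_ge0 ?normal_peak_ge0//.
by rewrite (le_trans K1)//; have /andP[] := Phi_01 0.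
Qed.

(** The part of the error constant that depends on the normal density: a
    Lipschitz constant of Phi plus a bound on the Stein solution at 0. *)
Definition stein_cst : R := normal_peak 1 + (normal_peak 1)^-1.

(** The Stein equation with g' replaced by a difference quotient. The mean value
    theorem turns the quotient into g' at a point c within dl of x, and the
    equation itself expresses g' c through Phi c, c and g c, which are all
    Lipschitz; no second derivative of g is used, as it does not exist where
    Phi x = s. The factor |x| is harmless, since only its mean matters. *)
Lemma stein_sol_difference s x dl : 0 <= s <= 1 -> 0 < dl ->
  `|Num.max 0 (s - Phi x) - s ^+ 2 / 2 -
    ((stein_sol s (x + dl) - stein_sol s x) / dl - x * stein_sol s x)| <=
  dl * (stein_cst + 4 * `|x| + 2 * dl).
Proof.
move=> s01 dl0.
have [c + ->] := mvt_dist (is_derive_stein_sol s) x (x + dl).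
rewrite [x + dl]addrC addrK (gtr0_norm dl0) mulfK ?gt_eqF// => cx.
set gx := stein_sol s x; set gc := stein_sol s c.
have -> : Num.max 0 (s - Phi x) - s ^+ 2 / 2 -
    (Num.max 0 (s - Phi c) - s ^+ 2 / 2 + c * gc - x * gx) =
  (Num.max 0 (s - Phi x) - Num.max 0 (s - Phi c)) + (x - c) * gx + c * (gx - gc).
  by ring.
have h1 : `|Num.max 0 (s - Phi x) - Num.max 0 (s - Phi c)| <= normal_peak 1 * dl.
  apply: le_trans (max0_lipschitz _ _) _.
  have -> : s - Phi x - (s - Phi c) = Phi c - Phi x by ring.
  by rewrite (le_trans (Phi_lipschitz _ _))// ler_wpM2l ?normal_peak_ge0.
have h2 : `|(x - c) * gx| <= dl * ((normal_peak 1)^-1 + 2 * `|x|).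
  by rewrite normrM ler_pM// ?stein_sol_le// distrC.
have h3 : `|c * (gx - gc)| <= (`|x| + dl) * (2 * dl).
  rewrite normrM ler_pM//.
    rewrite -[c](subrK x) addrC (le_trans (ler_normD _ _))// lerD2l//.
  rewrite distrC (le_trans (stein_sol_lipschitz _ _ s01))// ler_wpM2l//.
rewrite (le_trans (ler_normD _ _))// (le_trans (lerD (ler_normD _ _) (lexx _)))//.
rewrite (le_trans (lerD (lerD h1 h2) h3))// /stein_cst.
nra.
Qed.

End normal.

(** * Expectation over a weighted finite set *)

Section finite_expectation.
Context {R : realType} {V : finType}.
Variable w : V -> R.
Implicit Types f g : V -> R.

Definition mean f : R := \sum_v w v * f v.

Definition fin_variance f : R := mean (fun v => (f v - mean f) ^+ 2).

Lemma eq_mean f g : f =1 g -> mean f = mean g.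
Proof. by move=> fg; apply: eq_bigr => v _; rewrite fg. Qed.

Lemma meanD f g : mean (fun v => f v + g v) = mean f + mean g.
Proof. by rewrite -big_split; apply: eq_bigr => v _; rewrite mulrDr. Qed.

Lemma meanZ a f : mean (fun v => a * f v) = a * mean f.
Proof. by rewrite /mean big_distrr; apply: eq_bigr => v _; rewrite mulrCA. Qed.

Lemma meanN f : mean (fun v => - f v) = - mean f.
Proof. by rewrite /mean -sumrN; apply: eq_bigr => v _; rewrite mulrN. Qed.

Lemma meanB f g : mean (fun v => f v - g v) = mean f - mean g.
Proof. by rewrite meanD meanN. Qed.

Lemma mean_sum (I : Type) (r : seq I) (P : pred I) (F : I -> V -> R) :
  mean (fun v => \sum_(i <- r | P i) F i v) = \sum_(i <- r | P i) mean (F i).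
Proof.
rewrite /mean exchange_big; apply: eq_bigr => v _.
by rewrite big_distrr.
Qed.

Hypothesis w0 : forall v, 0 <= w v.
Hypothesis w1 : \sum_v w v = 1.

Lemma mean_cst a : mean (fun=> a) = a.
Proof. by rewrite /mean -big_distrl/= w1 mul1r. Qed.

Lemma mean_le f g : (forall v, f v <= g v) -> mean f <= mean g.
Proof. by move=> fg; apply: ler_sum => v _; rewrite ler_wpM2l. Qed.

Lemma mean_ge0 f : (forall v, 0 <= f v) -> 0 <= mean f.
Proof. by move=> f0; apply: sumr_ge0 => v _; rewrite mulr_ge0. Qed.

Lemma norm_mean f : `|mean f| <= mean (fun v => `|f v|).
Proof.
rewrite (le_trans (ler_norm_sum _ _ _))//; apply: ler_sum => v _.
by rewrite normrM ger0_norm.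
Qed.

Lemma fin_variance_ge0 f : 0 <= fin_variance f.
Proof. by apply: mean_ge0 => v; exact: sqr_ge0. Qed.

Lemma mean_sqrB f a : mean (fun v => (f v - a) ^+ 2) = fin_variance f + (mean f - a) ^+ 2.
Proof.
rewrite /fin_variance; set m := mean f.
have -> : mean (fun v => (f v - a) ^+ 2) =
  mean (fun v => (f v - m) ^+ 2 + (2 * (m - a) * (f v - m) + (m - a) ^+ 2)).
  by apply: eq_mean => v; ring.
by rewrite !meanD meanZ meanB !mean_cst subrr mulr0 add0r.
Qed.

Lemma fin_variance_le f a : fin_variance f <= mean (fun v => (f v - a) ^+ 2).
Proof. by rewrite mean_sqrB lerDl sqr_ge0. Qed.

Lemma fin_varianceE f : fin_variance f = mean (fun v => f v ^+ 2) - mean f ^+ 2.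
Proof.
have := mean_sqrB f 0; under eq_mean do rewrite subr0.
by move=> ->; rewrite subr0 addrK.
Qed.

(** The quadratic form (s, t) |-> E (s f - t g)^2 is nonnegative; if E g^2 = 0,
    a large t shows that E f g vanishes as well. *)
Lemma cauchy_schwarz f g : mean (fun v => f v * g v) ^+ 2 <=
  mean (fun v => f v ^+ 2) * mean (fun v => g v ^+ 2).
Proof.
set a := mean (fun v => f v ^+ 2); set b := mean (fun v => g v ^+ 2).
set c := mean (fun v => f v * g v).
have a0 : 0 <= a by apply: mean_ge0 => v; exact: sqr_ge0.
have b0 : 0 <= b by apply: mean_ge0 => v; exact: sqr_ge0.
have q s t : 0 <= s ^+ 2 * a - 2 * s * t * c + t ^+ 2 * b.
  have : 0 <= mean (fun v => (s * f v - t * g v) ^+ 2).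
    by apply: mean_ge0 => v; exact: sqr_ge0.
  have -> : mean (fun v => (s * f v - t * g v) ^+ 2) =
    mean (fun v => s ^+ 2 * f v ^+ 2 + ((- (2 * s * t)) * (f v * g v) +
      t ^+ 2 * g v ^+ 2)) by apply: eq_mean => v; ring.
  by rewrite !meanD !meanZ -/a -/b -/c addrA mulNr.
have [b00|bp] := eqVneq b 0.
  have [->|c0] := eqVneq c 0; first by rewrite expr0n mulr_ge0.
  (* With t = (a + 1) / c the form takes the value a - 2 (a + 1) < 0. *)
  have := q 1 ((a + 1) / c); rewrite b00 expr1n mul1r !mulr1 mulr0 addr0.
  by rewrite -mulrA divfK//; lra.
have bp' : 0 < b by rewrite lt_def bp.
(* For s = b the form is minimal at t = c. *)
have h := q b c; rewrite -(ler_pM2r bp'); nra.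
Qed.

Lemma mean_norm_sqr f : mean (fun v => `|f v|) ^+ 2 <= mean (fun v => f v ^+ 2).
Proof.
have := cauchy_schwarz (fun v => `|f v|) (fun=> 1).
rewrite (mean_cst (1 ^+ 2)) expr1n mulr1; under eq_mean do rewrite mulr1.
by move=> /le_trans; apply; apply: mean_le => v; rewrite real_normK ?num_real.
Qed.

End finite_expectation.

(** * From ramps to distribution functions *)

Section smoothing.
Context {R : realType} {V : finType} (w : V -> R).
Hypothesis w0 : forall v, 0 <= w v.
Hypothesis w1 : \sum_v w v = 1.

(** Under the uniform law on the unit interval the ramp max (0, s - u) has mean
    s^2 / 2, so the hypothesis says that Phi (U) is nearly uniform. With
    u = Phi a, the slope of s |-> E max (0, s - Phi U) on [u, u + h] bounds the
    probability of U <= a from above and its slope on [u - h, u] from below; for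
    the uniform law these slopes are u + h / 2 and u - h / 2. When the interval
    leaves the unit interval the bound is trivial. *)
Lemma kolmogorov_of_ramp (U : V -> R) (D : R) :
  (forall s, 0 <= s <= 1 ->
    `|mean w (fun v => Num.max 0 (s - Phi (U v))) - s ^+ 2 / 2| <= D) ->
  forall a h, 0 < h -> `|mean w (fun v => (U v <= a)%R%:R) - Phi a| <= h + 2 * D / h.
Proof.
move=> UD a h h0; set u := Phi a.
have /andP[u0 u1] : 0 <= u <= 1 := Phi_01 a.
have D0 : 0 <= D by apply: le_trans (UD 0 _); rewrite ?normr_ge0 ?lexx ?ler01.
have Dh0 : 0 <= 2 * D / h by rewrite divr_ge0 ?mulr_ge0// ltW.
have : h * (2 * D / h) = 2 * D by rewrite mulrC divfK ?gt_eqF.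
set k := 2 * D / h in Dh0 * => hk; set P := mean w _.
have P0 : 0 <= P by apply: mean_ge0 => // v; exact: ler0n.
have P1 : P <= 1.
  by rewrite -(mean_cst w1 1); apply: mean_le => // v; rewrite lern1 leq_b1.
pose F s := mean w (fun v => Num.max 0 (s - Phi (U v))).
have up : h * P <= F (u + h) - F u.
  rewrite /P /F -meanZ -meanB; apply: mean_le => // v.
  have := @Phi_nondecreasing R (U v) a; rewrite -/u.
  case: (U v <= a) => [/(_ isT)|_]; rewrite /= ?mulr1 ?mulr0;
    by case: (leP 0 (u + h - _)) => ?; case: (leP 0 (u - _)) => ? *; lra.
have low : F u - F (u - h) <= h * P.
  rewrite /P /F -meanZ -meanB; apply: mean_le => // v.
  have := @Phi_nondecreasing R a (U v); rewrite -/u.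
  case: (leP (U v) a) => [_ _|/ltW Ua /(_ Ua)]; rewrite /= ?mulr1 ?mulr0;
    by case: (leP 0 (u - h - _)) => ?; case: (leP 0 (u - _)) => ? *; lra.
have {}up : P - u <= h + k.
  have [uh|uh] := leP (u + h) 1; last by lra.
  have := UD u; have := UD (u + h); rewrite -/(F u) -/(F (u + h)) !ler_norml.
  rewrite u0 u1 uh addr_ge0 ?(ltW h0)// => /(_ isT)/andP[_ h1] /(_ isT)/andP[h2 _].
  by rewrite -(ler_pM2l h0); nra.
have {}low : u - P <= h + k.
  have [uh|uh] := leP 0 (u - h); last by lra.
  have := UD u; have := UD (u - h); rewrite -/(F u) -/(F (u - h)) !ler_norml.
  rewrite u0 u1 uh lerBlDr (le_trans u1) ?lerDl ?(ltW h0)//.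
  move=> /(_ isT)/andP[_ h1] /(_ isT)/andP[h2 _].
  by rewrite -(ler_pM2l h0); nra.
by rewrite ler_norml; apply/andP; split; lra.
Qed.

Lemma ramp_perturb (U W : V -> R) s :
  `|mean w (fun v => Num.max 0 (s - Phi (U v))) -
    mean w (fun v => Num.max 0 (s - Phi (W v)))| <=
  normal_peak 1 * mean w (fun v => `|U v - W v|).
Proof.
rewrite -meanB (le_trans (norm_mean w0 _))// -meanZ; apply: mean_le => // v.
rewrite (le_trans (max0_lipschitz _ _))//.
have -> : s - Phi (U v) - (s - Phi (W v)) = Phi (W v) - Phi (U v) by ring.
by rewrite (le_trans (Phi_lipschitz _ _))// distrC.
Qed.

End smoothing.

(** * Independent bits *)

Section cube.
Context {R : realType} (n : nat) (p : R).
Implicit Types v : {ffun 'I_n -> bool}.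

Definition cube_prob v : R := \prod_i bernoulli_pmf p (v i).

Lemma mean_prod_bits (F : 'I_n -> bool -> R) :
  mean cube_prob (fun v => \prod_i F i (v i)) =
  \prod_i (p * F i true + (1 - p) * F i false).
Proof.
rewrite /mean /cube_prob; under [LHS]eq_bigr do rewrite -big_split/=.
rewrite -(bigA_distr_bigA (fun i b => bernoulli_pmf p b * F i b)).
by apply: eq_bigr => i _; rewrite big_bool.
Qed.

Hypothesis p01 : 0 <= p <= 1.

Lemma cube_prob_ge0 v : 0 <= cube_prob v.
Proof. by apply: prodr_ge0 => i _; exact: bernoulli_pmf_ge0. Qed.

Lemma cube_prob_sum1 : \sum_v cube_prob v = 1.
Proof.
transitivity (mean cube_prob (fun=> \prod_(i < n) 1)).
  by apply: eq_bigr => v _; rewrite big1_eq mulr1.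
rewrite (mean_prod_bits (fun _ _ => 1)) big1// => i _.
by rewrite !mulr1 addrC subrK.
Qed.

Lemma mean_all_true (A : {set 'I_n}) :
  mean cube_prob (fun v => [forall i in A, v i]%:R) = p ^+ #|A|.
Proof.
have E v : [forall i in A, v i]%:R = \prod_i ((i \in A) ==> v i)%:R :> R.
  have [/'forall_implyP h|/forallPn[i h]] := boolP [forall i in A, v i].
    by rewrite big1// => i _; case: (boolP (i \in A)) => //= /h ->.
  by rewrite (bigD1 i)//= (negbTE h) mul0r.
under eq_mean do rewrite E.
rewrite (mean_prod_bits (fun i b => ((i \in A) ==> b)%:R)).
rewrite (bigID (mem A))/= [X in _ * X]big1 ?mulr1.
  rewrite (eq_bigr (fun=> p)) ?prodr_const// => i ->/=.
  by rewrite mulr1 mulr0 addr0.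
by move=> i /negbTE ->/=; rewrite !mulr1 addrC subrK.
Qed.

Definition zeros v : R := \sum_i (~~ v i)%:R.

Definition flip (i : 'I_n) v := [ffun j => if j == i then ~~ v j else v j].

Lemma flipK i : involutive (flip i).
Proof. by move=> v; apply/ffunP => j; rewrite !ffunE; case: eqP; rewrite ?negbK. Qed.

(** Flipping bit i exchanges the two sides: it multiplies the weight by p / q or
    q / p and changes the number of zeros by one. *)
Lemma mean_flip i (f : R -> R) :
  mean cube_prob (fun v => (v i)%:R * (1 - p) * f (zeros v + 1)) =
  mean cube_prob (fun v => (~~ v i)%:R * p * f (zeros v)).
Proof.
rewrite /mean (reindex_inj (inv_inj (flipK i))); apply: eq_bigr => v _.
rewrite ffunE eqxx; case: (boolP (v i)) => [|/negbTE] vi /=; first by rewrite !mul0r !mulr0.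
rewrite !mul1r !mulrA; congr (_ * f _).
  rewrite /cube_prob (bigD1 i)//= [in RHS](bigD1 i)//= ffunE eqxx vi/= mulrAC [RHS]mulrAC.
  rewrite [p * _]mulrC; congr (_ * _).
  by apply: eq_bigr => j /negbTE ji; rewrite ffunE ji.
rewrite /zeros (bigD1 i)//= [in RHS](bigD1 i)//= ffunE eqxx vi/= add0r addrC.
by congr (_ + _); apply: eq_bigr => j /negbTE ji; rewrite ffunE ji.
Qed.

(** Stein's identity for the binomial law, the sum over the bits of
    [mean_flip]. *)
Lemma stein_identity (f : R -> R) :
  mean cube_prob (fun v => (n%:R - zeros v) * (1 - p) * f (zeros v + 1)) =
  mean cube_prob (fun v => zeros v * p * f (zeros v)).
Proof.
have E v : n%:R - zeros v = \sum_i (v i)%:R.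
  apply/eqP; rewrite subr_eq -big_split/=; apply/eqP.
  rewrite (eq_bigr (fun=> 1)) ?sumr_const ?card_ord// => i _.
  by case: (v i); rewrite /= ?addr0 ?add0r.
under eq_mean do rewrite E 2!mulr_suml.
under [RHS]eq_mean do rewrite /zeros -/(zeros _) 2!mulr_suml.
by rewrite !mean_sum; apply: eq_bigr => i _; exact: mean_flip.
Qed.

Lemma mean_zeros : mean cube_prob zeros = n%:R * (1 - p).
Proof.
have := stein_identity (fun=> 1).
under eq_mean do rewrite mulr1 mulrC; under [RHS]eq_mean do rewrite mulr1 mulrC.
by rewrite !meanZ meanB mean_cst ?cube_prob_sum1//; lra.
Qed.

End cube.

(** * Normal approximation of the number of zeros *)

Section binomial_clt.
Context {R : realType} (n : nat) (p : R).
Hypothesis p01 : 0 <= p <= 1.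
Let q := 1 - p.
Let sg := Num.sqrt (n%:R * p * q).
Hypothesis sg1 : 1 <= sg.
Local Notation E := (mean (@cube_prob R n p)).
Let w0 := @cube_prob_ge0 R n p p01.
Let w1 := @cube_prob_sum1 R n p.

Definition std_zeros (v : {ffun 'I_n -> bool}) : R := (zeros v - n%:R * q) / sg.
Local Notation W := std_zeros.

(** [stein_identity] in the standardized variable W. With B = n q + s W the two
    coefficients (n - B) q and B p are s^2 - q s W and s^2 + p s W; dividing by s
    leaves the discrete form of g' - x g and a remainder carrying the step 1/s. *)
Lemma stein_identity_std (g : R -> R) :
  E (fun v => (g (W v + sg^-1) - g (W v)) / sg^-1 - W v * g (W v)
              - q * (W v * (g (W v + sg^-1) - g (W v)))) = 0.
Proof.
have s0 : sg != 0 by rewrite gt_eqF// (lt_le_trans ltr01).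
have sgE : sg ^+ 2 = n%:R * p * q.
  by rewrite sqr_sqrtr// !mulr_ge0 ?ler0n//; move: p01 => /andP[? ?]; rewrite ?subr_ge0.
have := @stein_identity R n p (fun x => g ((x - n%:R * q) / sg)).
move/eqP; rewrite -subr_eq0 -meanB => /eqP id0.
rewrite -[RHS](mulr0 sg^-1) -id0 -meanZ; apply: eq_mean => v.
have -> : (zeros v + 1 - n%:R * q) / sg = W v + sg^-1.
  by rewrite /std_zeros; field.
rewrite -/(W v); set gp := g (_ + _); set g0 := g _.
have -> : zeros v = n%:R * q + sg * W v by rewrite /std_zeros; field.
have sgE' : n%:R * p * q / sg = sg by rewrite -sgE expr2 mulfK.
rewrite invrK -/q.
transitivity (n%:R * p * q / sg * (gp - g0) - W v * g0 - q * (W v * (gp - g0))).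
  by rewrite sgE' mulrC.
by rewrite /q; field.
Qed.

(** The first two moments of W follow from Stein's identity for g = 1 and g = id. *)
Lemma mean_std_zeros : E W = 0.
Proof.
apply/eqP; rewrite -oppr_eq0 -meanN -(stein_identity_std (fun=> 1)).
by apply/eqP; apply: eq_mean => v; rewrite subrr mul0r !mulr0 subr0 sub0r mulr1.
Qed.

Lemma mean_sqr_std_zeros : E (fun v => W v ^+ 2) = 1.
Proof.
have s0 : sg != 0 by rewrite gt_eqF// (lt_le_trans ltr01).
transitivity (E (fun v => W v ^+ 2) + E (fun v => (1 - W v ^+ 2) + (- (q * sg^-1)) * W v)).
  rewrite -[LHS]addr0 -[in LHS](stein_identity_std id); congr (_ + _).
  by apply: eq_mean => v; field.
by rewrite meanD meanZ mean_std_zeros mulr0 addr0 meanB mean_cst// addrC subrK.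
Qed.

Lemma mean_norm_std_zeros : E (fun v => `|W v|) <= 1.
Proof.
have := mean_norm_sqr w0 w1 W; rewrite mean_sqr_std_zeros.
by rewrite expr_le1// mean_ge0.
Qed.

Lemma fin_variance_zeros : fin_variance (@cube_prob R n p) (@zeros R n) = sg ^+ 2.
Proof.
have s0 : sg != 0 by rewrite gt_eqF// (lt_le_trans ltr01).
transitivity (sg ^+ 2 * E (fun v => W v ^+ 2)); last first.
  by rewrite mean_sqr_std_zeros mulr1.
rewrite /fin_variance mean_zeros// -meanZ -/q.
by apply: eq_mean => v; rewrite /std_zeros; field.
Qed.

(** The mean of the ramp minus s^2 / 2 is the mean of the Stein equation error,
    up to the remainder of [stein_identity_std]; both have order 1 / sg because
    E |W| <= 1. *)
Lemma binomial_ramp s : 0 <= s <= 1 ->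
  `|E (fun v => Num.max 0 (s - Phi (W v))) - s ^+ 2 / 2| <= (@stein_cst R + 8) / sg.
Proof.
move=> s01; set g := stein_sol s.
have dl0 : 0 < sg^-1 by rewrite invr_gt0 (lt_le_trans ltr01).
have dl1 : sg^-1 <= 1 by rewrite invf_le1 ?(lt_le_trans ltr01).
set dl := sg^-1 in dl0 dl1 *.
have /andP[q0 q1] : 0 <= q <= 1 by move: p01; rewrite /q; lra.
have EN := mean_norm_std_zeros.
have -> : E (fun v => Num.max 0 (s - Phi (W v))) - s ^+ 2 / 2 =
  E (fun v => (Num.max 0 (s - Phi (W v)) - s ^+ 2 / 2 -
       ((g (W v + dl) - g (W v)) / dl - W v * g (W v))) +
     q * (W v * (g (W v + dl) - g (W v)))).
  rewrite -[LHS]subr0 -(stein_identity_std g) -{1}(mean_cst w1 (s ^+ 2 / 2)) -!meanB.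
  by apply: eq_mean => v; ring.
rewrite (le_trans (norm_mean w0 _))//.
apply: (@le_trans _ _ (E (fun v => dl * (stein_cst + 2 * dl) + 6 * dl * `|W v|))).
  apply: mean_le => // v; rewrite (le_trans (ler_normD _ _))//.
  have h1 := stein_sol_difference (W v) s01 dl0.
  have h2 : `|q * (W v * (g (W v + dl) - g (W v)))| <= `|W v| * (2 * dl).
    rewrite normrM -[leRHS]mul1r ler_pM//; first by rewrite ger0_norm.
    rewrite normrM ler_wpM2l// (le_trans (stein_sol_lipschitz _ _ s01))//.
    by rewrite addrC addKr gtr0_norm.
  rewrite (le_trans (lerD h1 h2))//; nra.
rewrite meanD mean_cst// meanZ.
have h1 : dl * dl <= dl by rewrite ler_piMr// ltW.
have h2 := ler_wpM2l (ltW dl0) EN.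
by rewrite mulr1 in h2; rewrite -/dl; nra.
Qed.

(** The parameter h is the smoothing width, to be chosen once the bracket is
    known to be small. *)
Lemma kolmogorov_near_binomial (U : {ffun 'I_n -> bool} -> R) a h : 0 < h ->
  `|E (fun v => (U v <= a)%R%:R) - Phi a| <=
  h + 2 * ((@stein_cst R + 8) / sg + normal_peak 1 * E (fun v => `|U v - W v|)) / h.
Proof.
apply: kolmogorov_of_ramp => // s s01.
set x := mean _ _; rewrite -[x](subrK (E (fun v => Num.max 0 (s - Phi (W v))))).
rewrite -addrA addrC (le_trans (ler_normD _ _))// lerD ?binomial_ramp//.
exact: ramp_perturb.
Qed.

End binomial_clt.

(** * Consecutive ones *)

Section pairs.
Context {n : nat}.
Implicit Types v : {ffun 'I_n -> bool}.

(** Reading bits at natural indices, with value [false] out of range, avoids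
    successors of ordinals. Bit k belongs to card k + 1. *)
Definition bit v (k : nat) : bool := if insub k is Some i then v i else false.

Lemma bit_ord v (i : 'I_n) : bit v i = v i.
Proof. by rewrite /bit valK. Qed.

(** The condition [c] stands for the decision of the player, which depends on n,
    p and k only; every bound below holds for all [c]. *)
Definition pairs (c : pred nat) v : nat :=
  (\sum_(k < n.-1) [&& c k, bit v k & bit v k.+1])%N.

Definition adjacent (k : nat) : {set 'I_n} := [set i | (val i == k) || (val i == k.+1)].

Lemma adjacentE v (k : nat) : (k.+1 < n)%N ->
  bit v k && bit v k.+1 = [forall i in adjacent k, v i].
Proof.
move=> kn; have k'n := ltnW kn; apply/andP/'forall_implyP => [[b0 b1] i|h].
  by rewrite inE => /orP[] /eqP ik; rewrite -bit_ord ik.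
have := h (Ordinal k'n); have := h (Ordinal kn).
by rewrite -!bit_ord !inE/= !eqxx orbT => /(_ isT) -> /(_ isT) ->.
Qed.

Lemma card_adjacent k : (k.+1 < n)%N -> #|adjacent k| = 2%N.
Proof.
move=> kn; have k'n := ltnW kn.
have -> : adjacent k = [set Ordinal k'n; Ordinal kn]%SET.
  by apply/setP => i; rewrite !inE -!val_eqE.
by rewrite cards2 -val_eqE /= neq_ltn ltnSn.
Qed.

Lemma adjacent_disjoint k l : (k.+1 < l)%N -> adjacent k :&: adjacent l = finset.set0.
Proof.
move=> kl; apply/setP => i; rewrite !inE; apply/negP.
by case/andP => /orP[] /eqP -> /orP[] /eqP; lia.
Qed.

Lemma sum_eq_ord m j : (\sum_(l < m) (l == j :> nat) = (j < m))%N.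
Proof.
elim: m => [|m IH]; first by rewrite big_ord0.
by rewrite big_ord_recr/= IH ltnS; case: ltngtP.
Qed.

Lemma sum_near m k : (\sum_(l < m) (k <= l.+1 <= k.+2) <= 3)%N.
Proof.
(* The indices l with |k - l| <= 1 are among k - 1, k and k + 1. *)
apply: (@leq_trans (\sum_(l < m) ((l == k.-1 :> nat) + (l == k :> nat) + (l == k.+1 :> nat)))%N).
  apply: leq_sum => l _; case: (boolP (k <= l.+1 <= k.+2)%N) => //= kl.
  have : [|| l == k.-1 :> nat, l == k :> nat | l == k.+1 :> nat] by lia.
  by do 3 case: (_ == _).
rewrite !big_split/= !sum_eq_ord.
by do 3 case: (_ < _)%N.
Qed.

Context {R : realType} (p : R).
Hypothesis p01 : 0 <= p <= 1.
Local Notation E := (mean (@cube_prob R n p)).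
Let w0 := @cube_prob_ge0 R n p p01.
Let w1 := @cube_prob_sum1 R n p.

Variable c : pred nat.
Let Z (k : nat) v : R := [&& c k, bit v k & bit v k.+1]%:R.

Let pairsE v : (pairs c v)%:R = \sum_(k < n.-1) Z k v.
Proof. by rewrite natr_sum. Qed.

Let ltk (k : 'I_n.-1) : (k.+1 < n)%N.
Proof. by have := ltn_ord k; lia. Qed.

Let Z01 k v : 0 <= Z k v <= 1.
Proof. by rewrite /Z; case: [&& _, _ & _]; rewrite /= ?lexx ?ler01. Qed.

Let mean_Z (k : 'I_n.-1) : E (Z k) = (c k)%:R * p ^+ 2.
Proof.
rewrite -(card_adjacent (ltk k)) -(mean_all_true (n:=n) p) -meanZ; apply: eq_mean => v.
by rewrite /Z adjacentE// -mulnb natrM.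
Qed.

Let mean_Z_le (k : 'I_n.-1) : E (Z k) <= p ^+ 2.
Proof. by rewrite mean_Z ler_piMl ?sqr_ge0// lern1 leq_b1. Qed.

Let mean_ZZ (k l : 'I_n.-1) : (k.+1 < l)%N -> E (fun v => Z k v * Z l v) = E (Z k) * E (Z l).
Proof.
move=> kl; rewrite !mean_Z.
transitivity (E (fun v => (c k)%:R * (c l)%:R * [forall i in adjacent k :|: adjacent l, v i]%:R)).
  apply: eq_mean => v; rewrite /Z !adjacentE// -!mulnb !natrM.
  rewrite mulrACA; congr (_ * _); rewrite -natrM mulnb; congr (_%:R); congr nat_of_bool.
  apply/andP/'forall_implyP => [[/'forall_implyP h1 /'forall_implyP h2] i|h].
    by rewrite inE => /orP[/h1|/h2].
  by split; apply/'forall_implyP => i ia; apply: h; rewrite inE ia ?orbT.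
rewrite meanZ mean_all_true cardsU adjacent_disjoint// cards0 !card_adjacent//.
by rewrite subn0 exprD mulrACA.
Qed.

Lemma mean_pairs_le : E (fun v => (pairs c v)%:R) <= n%:R * p ^+ 2.
Proof.
under eq_mean do rewrite pairsE.
rewrite mean_sum (le_trans (ler_sum _ (fun k _ => mean_Z_le k)))//.
by rewrite sumr_const card_ord -[leLHS]mulr_natl ler_wpM2r ?sqr_ge0// ler_nat leq_pred.
Qed.

(** Pairs at distance at least 2 share no bit, so they are uncorrelated; each of
    the at most 3 n remaining covariances is at most p^2. *)
Lemma fin_variance_pairs_le :
  fin_variance (@cube_prob R n p) (fun v => (pairs c v)%:R) <= 3 * n%:R * p ^+ 2.
Proof.
rewrite fin_varianceE//; under eq_mean do rewrite pairsE.
under [X in _ - X ^+ 2]eq_mean do rewrite pairsE.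
rewrite mean_sum.
have -> : E (fun v => (\sum_(k < n.-1) Z k v) ^+ 2) =
    \sum_(k < n.-1) \sum_(l < n.-1) E (fun v => Z k v * Z l v).
  under eq_mean do rewrite expr2 mulr_suml.
  rewrite mean_sum; apply: eq_bigr => k _; rewrite -mean_sum.
  by apply: eq_mean => v; rewrite mulr_sumr.
rewrite expr2 mulr_suml -sumrB.
apply: (@le_trans _ _ (\sum_(k < n.-1) 3 * p ^+ 2)); last first.
  rewrite sumr_const card_ord -[leLHS]mulr_natl mulrA [_ * 3]mulrC.
  by rewrite ler_wpM2r ?sqr_ge0// ler_wpM2l// ler_nat leq_pred.
apply: ler_sum => k _; rewrite mulr_sumr -sumrB.
apply: (@le_trans _ _ (\sum_(l < n.-1) (k <= l.+1 <= k.+2)%N%:R * p ^+ 2)).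
  apply: ler_sum => l _.
  have [kl|] := boolP (k <= l.+1 <= k.+2)%N.
    rewrite mul1r (le_trans _ (mean_Z_le k))// lerBlDr -[leLHS]addr0 lerD//.
      apply: mean_le => // v; have /andP[? ?] := Z01 k v; have /andP[? ?] := Z01 l v.
      exact: ler_piMr.
    by rewrite mulr_ge0// mean_ge0// => v; have /andP[] := Z01 k v; have /andP[] := Z01 l v.
  rewrite negb_and -!ltnNge mul0r => /orP[lk|kl].
    rewrite [_ * E (Z l)]mulrC -mean_ZZ//.
    by under eq_mean do rewrite mulrC; rewrite subrr.
  by rewrite mean_ZZ ?subrr//; lia.
rewrite -mulr_suml ler_wpM2r ?sqr_ge0// -natr_sum ler_nat.
exact: sum_near.
Qed.

End pairs.

(** * The shuffled deck and its correct guesses *)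

Section deck.

(** Here card n is sent to the top or to the bottom according to its own bit; in
    both cases it ends between the two groups, see [shelf_shuffleE]. *)
Lemma shelf_shuffle_nat n (b : pred nat) :
  shelf_shuffle (fun i : 'I_n => b i) =
  [seq k.+1 | k <- iota 0 n & b k] ++ rev [seq k.+1 | k <- iota 0 n & ~~ b k].
Proof.
rewrite /shelf_shuffle -val_enum_ord; elim: (enum 'I_n) => //= i s ->.
by case: (b i); rewrite //= rev_cons rcons_cat.
Qed.

Variables (m : nat) (b : pred nat).

Definition tops := [seq k.+1 | k <- iota 0 m & b k].
Definition bottoms := [seq k.+1 | k <- iota 0 m & ~~ b k].

Lemma shelf_shuffleE :
  shelf_shuffle (fun i : 'I_m.+1 => b i) = tops ++ m.+1 :: rev bottoms.
Proof.
rewrite shelf_shuffle_nat -addn1 iotaD !filter_cat !map_cat /= add0n addn1.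
by case: (b m); rewrite /= ?cats0 -?catA //= cats1 rev_rcons.
Qed.

Lemma perm_deck : perm_eq (tops ++ m.+1 :: rev bottoms) (iota 1 m.+1).
Proof.
have -> : iota 1 m.+1 = rcons [seq k.+1 | k <- iota 0 m] m.+1.
  by rewrite -[m.+1 in LHS]addn1 iotaD add1n -(iotaDl 1 0) cats1.
rewrite perm_sym perm_rcons perm_sym.
apply: perm_trans (permEl (perm_catCA tops [:: m.+1] (rev bottoms))) _.
rewrite /= perm_cons; apply: (@perm_trans _ (tops ++ bottoms)).
  by rewrite perm_cat2l perm_rev.
by rewrite -map_cat perm_map// perm_filterC.
Qed.

Lemma tops_le k : k \in tops -> (0 < k <= m)%N.
Proof. by case/mapP => j; rewrite mem_filter mem_iota => /andP[_ /andP[_ ?]] ->. Qed.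

Lemma tops_sorted : sorted ltn tops.
Proof.
rewrite sorted_map; apply: sorted_filter; first exact: ltn_trans.
exact: iota_ltn_sorted.
Qed.

Lemma bottoms_sorted : sorted geq (rev bottoms).
Proof.
rewrite rev_sorted; apply: (@sub_sorted _ ltn); first by move=> x y /ltnW.
rewrite sorted_map; apply: sorted_filter; first exact: ltn_trans.
exact: iota_ltn_sorted.
Qed.

End deck.

Section tally.
Local Open Scope nat_scope.

(** Keeping the cards already shown as an argument of [F] makes the count of
    correct guesses additive over concatenation. *)
Definition tally (F : seq nat -> nat -> bool) (s : seq nat) : nat :=
  \sum_(i < size s) F (take i s) (nth 0 s i).

Lemma tally_cat F s t :
  tally F (s ++ t) = tally F s + tally (fun u => F (s ++ u)) t.
Proof.
rewrite /tally size_cat big_split_ord/=; congr (_ + _); apply: eq_bigr => i _.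
  by rewrite takel_cat ?nth_cat ?ltn_ord// ltnW.
by rewrite take_cat nth_cat ltnNge leq_addr/= addKn.
Qed.

Lemma tally_cons F x s :
  tally F (x :: s) = F [::] x + tally (fun u => F (x :: u)) s.
Proof. by rewrite -cat1s tally_cat /tally big_ord_recl big_ord0 addn0. Qed.

Lemma tally_rcons F s x : tally F (rcons s x) = tally F s + F s x.
Proof. by rewrite -cats1 tally_cat tally_cons /tally big_ord0 addn0 cats0. Qed.

Lemma eq_tally F G s :
  (forall i, i < size s -> F (take i s) (nth 0 s i) = G (take i s) (nth 0 s i)) ->
  tally F s = tally G s.
Proof. by move=> FG; apply: eq_bigr => i _; rewrite FG. Qed.

Lemma bigmax_eqP (r : seq nat) (P : pred nat) M : M \in r -> P M ->
  {in r, forall k, P k -> k <= M} -> \max_(k <- r | P k) k = M.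
Proof.
move=> Mr PM le; apply/eqP; rewrite eqn_leq; apply/andP; split.
  by apply/bigmax_leqP_seq => k; exact: le.
exact: (@leq_bigmax_seq _ _ _ id).
Qed.

Variables (R : realType) (p : R) (m : nat) (b : pred nat).
Let n := m.+1.

(** The player guesses card n rather than card j + 1. *)
Definition wait (j : nat) : bool := ((p < 2^-1) && (n%:Z - j%:Z <= nu p))%R.

(** Once card n has been shown, the largest remaining card is the next one,
    because the rest of the deck is decreasing. *)
Lemma tally_bottoms :
  tally (fun u x => guess p n (tops m b ++ n :: u) == x) (rev (bottoms m b))
  = size (bottoms m b).
Proof.
rewrite -size_rev; set B := rev _.
transitivity (tally (fun _ _ => true) B); last by rewrite /tally sum1_card card_ord.
apply: eq_tally => i iB; rewrite /guess.
have pd := perm_deck m b; rewrite -/n -/B in pd.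
have ud : uniq (tops m b ++ n :: B) by rewrite (perm_uniq pd) iota_uniq.
rewrite mem_cat mem_head orbT/=; apply/eqP; apply: bigmax_eqP.
- by rewrite -(perm_mem pd) mem_cat in_cons mem_nth ?orbT.
- move: ud; rewrite -[in X in uniq X](cat_take_drop i B) (drop_nth 0 iB).
  rewrite -cat_cons catA cat_uniq => /and3P[_ + _].
  by rewrite /= negb_or => /andP[].
- move=> k; rewrite -(perm_mem pd) -[in X in k \in X](cat_take_drop i B).
  rewrite -cat_cons catA mem_cat => /orP[->//|].
  rewrite (drop_nth 0 iB) in_cons => /predU1P[->//|kd] _.
  have /cat_sorted2[_] : sorted geq (take i B ++ drop i B).
    by rewrite cat_take_drop; exact: bottoms_sorted.
  by rewrite (drop_nth 0 iB) /= => /(order_path_min (rev_trans leq_trans))/allP/(_ _ kd).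
Qed.

(** Among the top cards the shown cards are smaller than the next one, so
    neither n nor n - 1 has been shown; guessing n is then wrong. *)
Lemma tally_tops :
  tally (fun u x => guess p n u == x) (tops m b) =
  tally (fun u x => ~~ wait (last 0 u) && ((last 0 u).+1 == x)) (tops m b).
Proof.
apply: eq_tally => i it.
have xt : nth 0 (tops m b) i \in tops m b by exact: mem_nth.
have /andP[_ xm] := tops_le xt; set x := nth 0 _ i in xt xm *.
have lt_take k : k \in take i (tops m b) -> k < x.
  case/(nthP 0) => j; rewrite size_takel ?(ltnW it)// => ji <-.
  rewrite nth_take//; apply: (sorted_ltn_nth ltn_trans 0 (tops_sorted m b)) => //.
  by rewrite inE (ltn_trans ji).
rewrite /guess ifN; last first.
  rewrite negb_or; apply/andP; split; apply/negP => /lt_take; rewrite ltnNge ?xm//.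
  by rewrite (leq_trans xm).
by rewrite -/(wait _); case: ifP => //= _; rewrite gtn_eqF// ltnS.
Qed.

Lemma last_tops_le : last 0 (tops m b) <= m.
Proof.
have := mem_last 0 (tops m b); rewrite in_cons => /predU1P[->//|].
by case/tops_le/andP.
Qed.

Lemma topsS k : tops k.+1 b = if b k then rcons (tops k b) k.+1 else tops k b.
Proof.
rewrite /tops -addn1 iotaD filter_cat map_cat /= add0n.
by case: (b k); rewrite ?cats0 // cats1 addn1.
Qed.

End tally.

(** The default value 0 of [last] is the label used before the first guess; the
    case m = 0 is the empty list of top cards. *)
Lemma last_tops (b : pred nat) m : (last 0 (tops m b) == m)%N = (m == 0)%N || b m.-1.
Proof.
case: m => [|m]; first by rewrite /tops.
rewrite topsS /=; case: (b m); first by rewrite last_rcons eqxx.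
by rewrite ltn_eqF// ltnS last_tops_le.
Qed.

(** Adding card m + 1 to the top cards adds a correct guess exactly when the
    player guesses the successor of the last top card and this successor is
    m + 1, that is, when card m is on top as well or m = 0. *)
Lemma tally_tops_sum (b W : pred nat) m :
  tally (fun u x => ~~ W (last 0 u) && ((last 0 u).+1 == x)) (tops m b) =
  (\sum_(k < m) [&& b k, ~~ W k & (k == 0 :> nat) || b k.-1])%N.
Proof.
elim: m => [|m IH]; first by rewrite /tally /= !big_ord0.
rewrite big_ord_recr/= -IH topsS; case: (b m); last by rewrite addn0.
rewrite tally_rcons eqSS last_tops; congr (_ + nat_of_bool _)%N.
have := last_tops b m; case: (_ || _); rewrite ?andbF ?andbT// => /eqP ->//.
Qed.

(** The term k = 0 is the first guess, which follows no card. The condition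
    k + 1 < m keeps card n = m + 1 out of the pairs, although its bit may be 1. *)
Lemma sum_top_pairs (b W : pred nat) m : exists e : bool,
  (\sum_(k < m) [&& b k, ~~ W k & (k == 0 :> nat) || b k.-1] =
   e + \sum_(k < m) [&& ~~ W k.+1 && (k.+1 < m), b k & b k.+1])%N.
Proof.
case: m => [|m]; first by exists false; rewrite !big_ord0.
exists (b 0%N && ~~ W 0%N).
rewrite big_ord_recl [in RHS]big_ord_recr/= ltnn !andbF addn0 andbT.
congr (_ + _)%N; apply: eq_bigr => k _.
rewrite ltnS ltn_ord andbT /bump/= add1n/=.
by case: (b k); rewrite ?andbF ?andbT//= andbC.
Qed.

Lemma count_iota (a : pred nat) m : count a (iota 0 m) = (\sum_(k < m) a k)%N.
Proof. by rewrite -sumn_count sumnE big_map -[in LHS](subn0 m) big_mkord. Qed.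

(** The discrepancies are the first guess, the guess made when card n comes up,
    and the term of card n in the number of zeros. *)
Lemma correct_guesses_approx (R : realType) (p : R) n :
  exists c : pred nat, forall v : {ffun 'I_n -> bool},
    (\sum_i ~~ v i + pairs c v <= correct_guesses p n (shelf_shuffle v) + 1)%N /\
    (correct_guesses p n (shelf_shuffle v) <= \sum_i ~~ v i + pairs c v + 2)%N.
Proof.
case: n => [|m].
  exists pred0; move=> v.
  have -> : shelf_shuffle v = [::].
    by apply: size0nil; rewrite /shelf_shuffle (size0nil (s := enum 'I_0))// size_enum_ord.
  by rewrite /correct_guesses /pairs !big_ord0.
exists (fun k => ~~ wait p m k.+1 && (k.+1 < m)%N) => v /=.
have -> : (v : 'I_m.+1 -> bool) = (fun i => bit v i).
  by apply/funext => i; rewrite bit_ord.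
have cgE s : correct_guesses p m.+1 s = tally (fun u x => guess p m.+1 u == x) s by [].
rewrite shelf_shuffleE cgE.
rewrite tally_cat tally_cons cats0 tally_bottoms tally_tops tally_tops_sum.
rewrite /bottoms size_map size_filter.
have -> : (\sum_(i < m.+1) ~~ bit v i = count (fun k => ~~ bit v k) (iota 0 m) + ~~ bit v m)%N.
  rewrite big_ord_recr/=; congr (_ + _)%N.
  by rewrite count_iota.
rewrite /pairs /= {cgE}; set g := guess _ _ _ == _; set z := ~~ _.
have [e ->] := sum_top_pairs (bit v) (wait p m) m.
set S := (\sum_(k < m) _)%N; set C := count _ _.
by clearbody S C; case: e; case: g; case: z; lia.
Qed.

(** * From random bits to the cube *)

Section law.
Context d (T : measurableType d) (R : realType) (P : probability T R).
Context (n : nat) (p : R) (eps : 'I_n -> {RV P >-> bool}).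
Hypothesis p01 : 0 <= p <= 1.
Hypothesis eps_iid : iid_bernoulli p eps.

Definition outcome (w : T) : {ffun 'I_n -> bool} := [ffun i => eps i w].

Let outcome_eq v : outcome @^-1` [set v] = \bigcap_i (eps i @^-1` [set v i]).
Proof.
apply/seteqP; split => [w /= <- i _|w vw] /=; first by rewrite ffunE.
by apply/ffunP => i; rewrite ffunE; exact: vw.
Qed.

Lemma measurable_outcome v : measurable (outcome @^-1` [set v]).
Proof.
rewrite outcome_eq.
by apply: fin_bigcap_measurable => // i _; exact: measurable_funPTI.
Qed.

Lemma outcome_law v : P (outcome @^-1` [set v]) = (cube_prob p v)%:E.
Proof.
rewrite outcome_eq (eps_iid.1 (fun i => [set v i])) // /cube_prob -prodEFin.
apply: eq_bigr => i _; have := eps_iid.2 i [set v i].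
rewrite /distribution /pushforward => ->; rewrite /bernoulli_prob p01.
by rewrite fsbig_set1.
Qed.

(** Nonnegative functions are enough: probabilities, the mean of the score and
    its variance are all of this form, and no integrability has to be checked. *)
Lemma integral_outcome (G : {ffun 'I_n -> bool} -> R) : (forall v, 0 <= G v) ->
  (\int[P]_w (G (outcome w))%:E)%E = (mean (cube_prob p) G)%:E.
Proof.
move=> G0.
have GE w : (G (outcome w))%:E =
    (\sum_(v : {ffun 'I_n -> bool}) (G v)%:E * (\1_(outcome @^-1` [set v]) w)%:E)%E.
  rewrite (bigD1 (outcome w))//= indicE mem_set//= mule1 big1 ?adde0// => v vw.
  by rewrite indicE memNset ?mule0// => /= E; rewrite E eqxx in vw.
under eq_integral do rewrite GE.
rewrite ge0_integral_sum//=; last 2 first.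
- move=> v; apply: measurable_funeM; apply/measurable_realfun.measurable_EFinP.
  by apply: measurable_realfun.measurable_indic; exact: measurable_outcome.
- by move=> v w _; rewrite mule_ge0// lee_fin.
rewrite /mean -sumEFin; apply: eq_bigr => v _.
have mv := measurable_outcome v.
rewrite ge0_integralZl_EFin//=; last first.
  by apply/measurable_realfun.measurable_EFinP; exact: measurable_realfun.measurable_indic.
by rewrite integral_indic// setIT [X in (_ * X)%E]outcome_law -EFinM mulrC.
Qed.

Lemma prob_outcome (A : pred {ffun 'I_n -> bool}) :
  P [set w | A (outcome w)] = (mean (cube_prob p) (fun v => (A v)%:R))%:E.
Proof.
rewrite -integral_outcome; last by move=> v; rewrite ler0n.
have -> : [set w | A (outcome w)] = \bigcup_(v in [set v | A v]) (outcome @^-1` [set v]).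
  apply/seteqP; split => [w Aw|w [v Av /= ->]//].
  by exists (outcome w).
rewrite -[X in P X]setIT -integral_indic//; last first.
  apply: fin_bigcup_measurable; first exact: finite_finset.
  by move=> v _; exact: measurable_outcome.
apply: eq_integral => w _; congr EFin; rewrite indicE; congr (_%:R); congr nat_of_bool.
apply/idP/idP; first by rewrite inE => -[v Av /= ->].
by move=> Aw; rewrite inE; exists (outcome w).
Qed.

Lemma expectation_outcome (X : T -> R) (G : {ffun 'I_n -> bool} -> R) :
  (forall v, 0 <= G v) -> (forall w, X w = G (outcome w)) ->
  ('E_P[X])%E = (mean (cube_prob p) G)%:E.
Proof.
move=> G0 XG; rewrite unlock -integral_outcome//.
by apply: eq_integral => w _; rewrite XG.
Qed.

Lemma variance_outcome (X : T -> R) (G : {ffun 'I_n -> bool} -> R) :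
  (forall v, 0 <= G v) -> (forall w, X w = G (outcome w)) ->
  ('V_P[X])%E = (fin_variance (cube_prob p) G)%:E.
Proof.
move=> G0 XG; rewrite /variance unlock (expectation_outcome G0 XG)/= /fin_variance.
apply: expectation_outcome => [v|w]; first exact: sqr_ge0.
by rewrite -XG expr2.
Qed.

Definition score (v : {ffun 'I_n -> bool}) : R := (correct_guesses p n (shelf_shuffle v))%:R.

Lemma num_correct_outcome w : num_correct p eps w = score (outcome w).
Proof.
rewrite /num_correct /score; congr (correct_guesses p n _)%:R; congr shelf_shuffle.
by apply/funext => i; rewrite ffunE.
Qed.

Lemma cdf_standardize m s x :
  cdf (standardize_RV (num_correct_RV p eps) m s) x =
  (mean (cube_prob p) (fun v => ((score v - m) / s <= x)%R%:R))%:E.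
Proof.
rewrite -(prob_outcome (fun v => (score v - m) / s <= x)) /cdf /distribution /pushforward.
congr (P _); apply/seteqP; split => w /=; rewrite in_itv /= -num_correct_outcome; exact.
Qed.

End law.

(** * Distance of the score to the normal law *)

Section score_bounds.
Context {R : realType} (n : nat) (p : R).
Hypothesis p01 : 0 <= p <= 1.
Let q := 1 - p.
Let sg := Num.sqrt (n%:R * p * q).
Local Notation w := (@cube_prob R n p).
Local Notation E := (mean w).
Let w0 := @cube_prob_ge0 R n p p01.
Let w1 := @cube_prob_sum1 R n p.
Local Notation S := (@score R n p).

(** What the score gains over the number of zeros, namely a number of pairs up
    to a bounded term. *)
Definition excess v : R := S v - zeros v.

Lemma score_pairs : exists c : pred nat, forall v, `|excess v - (pairs c v)%:R| <= 2.
Proof.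
have [c cP] := correct_guesses_approx p n; exists c => v.
have [h1 h2] := cP v; move: h1 h2; rewrite -!(ler_nat R) !natrD natr_sum.
rewrite -/(zeros v) -/(score p v) => h1 h2.
by rewrite ler_norml /excess; apply/andP; split; lra.
Qed.

Lemma mean_norm_excess : E (fun v => `|excess v|) <= n%:R * p ^+ 2 + 2.
Proof.
have [c cP] := score_pairs.
apply: (@le_trans _ _ (E (fun v => (pairs c v)%:R + 2))).
  apply: mean_le => // v; rewrite -[X in `|X|](subrK (pairs c v)%:R) addrC.
  by rewrite (le_trans (ler_normD _ _))// lerD// ger0_norm.
by rewrite meanD mean_cst// lerD2r mean_pairs_le.
Qed.

Lemma fin_variance_excess : fin_variance w excess <= 6 * n%:R * p ^+ 2 + 8.
Proof.
have [c cP] := score_pairs.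
set m := E (fun v => (pairs c v)%:R).
apply: le_trans (fin_variance_le w1 _ m) _.
apply: (@le_trans _ _ (E (fun v => 2 * ((pairs c v)%:R - m) ^+ 2 + 8))).
  apply: mean_le => // v; have := cP v.
  rewrite ler_norml => /andP[]; set e := excess v; set y := (pairs c v)%:R => h1 h2.
  (* (d + z)^2 <= 2 d^2 + 2 z^2 with d = e - y, |d| <= 2, and z = y - m. *)
  have : 0 <= (2 - (e - y)) * (2 + (e - y)) by apply: mulr_ge0; lra.
  have := sqr_ge0 ((e - y) - (y - m)); nra.
rewrite meanD mean_cst// meanZ lerD2r.
have := @fin_variance_pairs_le n R p p01 c; rewrite /fin_variance -/m; lra.
Qed.

(** For the weak law: the score misses n by at most the number of ones plus
    the excess. *)
Lemma mean_norm_defect : E (fun v => `|S v - n%:R|) <= n%:R * p + n%:R * p ^+ 2 + 2.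
Proof.
apply: (@le_trans _ _ (E (fun v => (n%:R - zeros v) + `|excess v|))).
  apply: mean_le => // v.
  have -> : S v - n%:R = excess v - (n%:R - zeros v) by rewrite /excess; ring.
  rewrite (le_trans (ler_normB _ _))// addrC lerD2r ger0_norm// subr_ge0.
  rewrite /zeros -natr_sum ler_nat -[leqRHS]card_ord -sum1_card.
  by apply: leq_sum => i _; exact: leq_b1.
rewrite meanD meanB mean_cst// mean_zeros//.
by have := mean_norm_excess; lra.
Qed.

Hypothesis sg1 : 1 <= sg.
Let sg0 : 0 < sg. Proof. exact: lt_le_trans sg1. Qed.
Local Notation W := (@std_zeros R n p).
Local Notation C0 := (@stein_cst R + 8).
Local Notation M := (@normal_peak R 1).

Lemma kolmogorov_centered a h : 0 < h ->
  `|E (fun v => ((S v - n%:R * q) / sg <= a)%R%:R) - Phi a| <=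
  h + 2 * (C0 / sg + M * ((n%:R * p ^+ 2 + 2) / sg)) / h.
Proof.
move=> h0; apply: le_trans (kolmogorov_near_binomial p01 sg1 _ a h0) _.
rewrite lerD2l ler_wpM2r ?invr_ge0 ?(ltW h0)// ler_wpM2l// lerD2l.
rewrite ler_wpM2l ?normal_peak_ge0// ler_pdivlMr// mulrC -meanZ.
apply: le_trans mean_norm_excess; apply: mean_le => // v.
rewrite -[X in X * _]gtr0_norm// -normrM.
rewrite le_eqVlt; apply/orP; left; apply/eqP; congr `|_|.
rewrite /std_zeros /excess -/q -/sg; field.
by rewrite gt_eqF.
Qed.

Let K := Num.sqrt (fin_variance w excess).
Let s := Num.sqrt (fin_variance w S).

Let mean_S : E S = n%:R * q + E excess.
Proof.
by rewrite -mean_zeros// -meanD; apply: eq_mean => v; rewrite /excess addrC subrK.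
Qed.

(* The triangle inequality for standard deviations. *)
Let stddev_close : `|s - sg| <= K.
Proof.
have s0 : 0 <= s := sqrtr_ge0 _. have K0 : 0 <= K := sqrtr_ge0 _.
have s2 : s ^+ 2 = fin_variance w S by rewrite sqr_sqrtr// fin_variance_ge0.
have K2 : K ^+ 2 = fin_variance w excess by rewrite sqr_sqrtr// fin_variance_ge0.
have g2 := fin_variance_zeros p01 sg1; rewrite -/sg in g2.
set c := E (fun v => (zeros v - E (@zeros R n)) * (excess v - E excess)).
have cs : c ^+ 2 <= (sg * K) ^+ 2.
  by rewrite exprMn K2 -g2; exact: cauchy_schwarz.
have cabs : `|c| <= sg * K.
  by rewrite -ler_sqr ?nnegrE ?mulr_ge0 ?(ltW sg0)// real_normK ?num_real.
have E2 : s ^+ 2 = sg ^+ 2 + 2 * c + K ^+ 2.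
  rewrite s2 -g2 K2 /fin_variance -meanZ -!meanD; apply: eq_mean => v.
  by rewrite mean_S mean_zeros// -/q /excess; ring.
move: cabs; rewrite !ler_norml => /andP[c1 c2]; apply/andP; split.
  have [sK|/ltW Ks] := leP sg K; first by lra.
  suff : sg - K <= s by lra.
  by rewrite -ler_sqr ?nnegrE ?subr_ge0// E2 sqrrB mulr2n; lra.
suff : s <= sg + K by lra.
by rewrite -ler_sqr ?nnegrE ?addr_ge0 ?(ltW sg0)// E2 sqrrD mulr2n; lra.
Qed.

(** With m and s the mean and standard deviation of the score, the difference
    (S - m) / s - W is (S - m) (1 / s - 1 / sg) + (excess - its mean) / sg. The
    first term has mean absolute value at most s |1 / s - 1 / sg| <= K / sg by
    [stddev_close], the second at most K / sg. If s = 0 both S - m and the first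
    term vanish. *)
Lemma kolmogorov_standardized a h : 0 < h ->
  `|E (fun v => ((S v - E S) / s <= a)%R%:R) - Phi a| <=
  h + 2 * (C0 / sg + M * (2 * (K / sg))) / h.
Proof.
move=> h0; apply: le_trans (kolmogorov_near_binomial p01 sg1 _ a h0) _.
rewrite lerD2l ler_wpM2r ?invr_ge0 ?(ltW h0)// ler_wpM2l// lerD2l.
rewrite ler_wpM2l ?normal_peak_ge0//.
have s0 : 0 <= s := sqrtr_ge0 _. have K0 : 0 <= K := sqrtr_ge0 _.
have L1S : E (fun v => `|S v - E S|) <= s.
  rewrite -ler_sqr ?nnegrE ?mean_ge0// sqr_sqrtr ?fin_variance_ge0//.
  exact: mean_norm_sqr.
have L1Z : E (fun v => `|excess v - E excess|) <= K.
  rewrite -ler_sqr ?nnegrE ?mean_ge0// sqr_sqrtr ?fin_variance_ge0//.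
  exact: mean_norm_sqr.
apply: (@le_trans _ _ (E (fun v => `|s^-1 - sg^-1| * `|S v - E S| + sg^-1 * `|excess v - E excess|))).
  apply: mean_le => // v.
  have -> : (S v - E S) / s - W v =
      (s^-1 - sg^-1) * (S v - E S) + sg^-1 * (excess v - E excess).
    have eS : S v - E S = (zeros v - n%:R * q) + (excess v - E excess).
      have -> : S v = zeros v + excess v by rewrite /excess addrC subrK.
      by rewrite mean_S; ring.
    by rewrite /std_zeros -/q -/sg [in RHS]mulrBl [in sg^-1 * (S v - E S)]eS; ring.
  by rewrite (le_trans (ler_normD _ _))// !normrM (gtr0_norm (_ : 0 < sg^-1)) ?invr_gt0.
rewrite meanD !meanZ mulr_natl mulr2n lerD//; last by rewrite mulrC ler_wpM2r// invr_ge0 ltW.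
have [s00|s00] := eqVneq s 0.
  have -> : E (fun v => `|S v - E S|) = 0.
    by apply/eqP; rewrite eq_le mean_ge0// andbT -s00.
  by rewrite mulr0 divr_ge0// ltW.
apply: (@le_trans _ _ (`|s^-1 - sg^-1| * s)); first by rewrite ler_wpM2l.
have sp : 0 < s by rewrite lt_def s00.
have -> : s^-1 - sg^-1 = (sg - s) / (s * sg) by field; rewrite s00 gt_eqF.
rewrite normrM normfV (gtr0_norm (_ : 0 < s * sg)) ?mulr_gt0// invfM mulrA mulrAC divfK//.
by rewrite distrC ler_wpM2r// invr_ge0 ltW.
Qed.

End score_bounds.

(** * Asymptotics *)

Section limits.
Context {R : realType}.

(** For a precision e the width h = e / 2 works as soon as D n <= e^2 / 8. *)
Lemma cvg_of_kolmogorov (F D : nat -> R) (L : R) :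
  (\forall n \near \oo, forall h, 0 < h -> `|F n - L| <= h + 2 * D n / h) ->
  D n @[n --> \oo] --> (0 : R) -> F n @[n --> \oo] --> L.
Proof.
move=> FD D0; apply/cvgrPdist_le => e e0.
have e8 : 0 < e ^+ 2 / 8 by rewrite divr_gt0// exprn_gt0.
have h0 : 0 < e / 2 by rewrite divr_gt0.
near=> n; rewrite distrC.
have /(_ _ h0) : forall h, 0 < h -> `|F n - L| <= h + 2 * D n / h by near: n.
move=> /le_trans; apply.
have Dn : D n <= e ^+ 2 / 8.
  rewrite (le_trans (ler_norm _))//.
  by near: n; exact: (cvgr0_norm_le _ D0 _ e8).
rewrite -lerBrDl ler_pdivrMr//; nra.
Unshelve. all: by end_near. Qed.

Lemma sqrt_cvg0 (u : nat -> R) :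
  u n @[n --> \oo] --> (0 : R) -> Num.sqrt (u n) @[n --> \oo] --> (0 : R).
Proof.
move=> u0; rewrite -[X in _ --> X](@sqrtr0 R).
exact: (cvg_comp _ _ u0 (@sqrt_continuous R 0)).
Qed.

(** For p <= 1/2 the factor 1 - p costs at most 2, so that a standard deviation
    can be compared with n p. *)
Lemma sqrt_div_std (n p a : R) : 0 < n -> 0 < p -> p <= 2^-1 -> 0 <= a ->
  Num.sqrt a / Num.sqrt (n * p * (1 - p)) <= Num.sqrt (2 * a * (n^-1 / p)).
Proof.
move=> n0 p0 p2 a0; rewrite -sqrtrV; last by rewrite !mulr_ge0 ?ltW//; lra.
rewrite -sqrtrM// ler_sqrt; last by rewrite !mulr_ge0 ?invr_ge0// ltW.
have q2 : (1 - p)^-1 <= 2 by rewrite -[leRHS]invrK lef_pV2 ?posrE//; lra.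
have r0 : 0 <= a * (n^-1 / p) by rewrite mulr_ge0// divr_ge0 ?invr_ge0// ltW.
have -> : (n * p * (1 - p))^-1 = n^-1 / p * (1 - p)^-1 by rewrite !invfM.
rewrite mulrA [2 * a]mulrC [leRHS]mulrAC.
by rewrite ler_wpM2l.
Qed.

(** ln x is twice ln (sqrt x), and ln is below the identity. *)
Lemma ln_le_sqrt (x : R) : 0 < x -> ln x <= 2 * Num.sqrt x.
Proof.
move=> x0; have s0 : 0 < Num.sqrt x by rewrite sqrtr_gt0.
rewrite -[in leLHS](sqr_sqrtr (ltW x0)) lnXn// -[leLHS]mulr_natl.
by rewrite ler_wpM2l// ltW// ln_sublinear.
Qed.

Lemma ln_sub_lnln_bounds (x : R) : expR 1 <= x ->
  1 <= ln x - ln (ln x) /\ ln x - ln (ln x) <= 2 * Num.sqrt x.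
Proof.
move=> ex; have x0 : 0 < x by rewrite (lt_le_trans _ ex)// expR_gt0.
have l1 : 1 <= ln x by rewrite -(expRK 1) ler_ln ?posrE ?expR_gt0.
split; last by rewrite (le_trans _ (ln_le_sqrt x0))// gerBl ln_ge0.
have := @le_ln1Dx R (ln x - 1); rewrite [1 + _]addrC subrK => h.
by have := h ltac:(lra); lra.
Qed.

End limits.

Section asymptotics.
Context {R : realType} (p : nat -> R) (d : nat -> measure_display)
  (T : forall n, measurableType (d n)) (P : forall n, probability (T n) R)
  (eps : forall n, 'I_n -> {RV (P n) >-> bool}).
Hypothesis p01 : forall n, 0 < p n < 1.
Hypothesis p0 : p n @[n --> \oo] --> 0.
Hypothesis eps_iid : forall n, iid_bernoulli (p n) (@eps n).

Let p01' n : 0 <= p n <= 1.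
Proof. by case/andP: (p01 n) => *; rewrite !ltW. Qed.

Let sg n := Num.sqrt (n%:R * p n * (1 - p n)).

Let near_half : \forall n \near \oo, p n <= 2^-1.
Proof.
have h : 0 < 2^-1 :> R by rewrite invr_gt0.
near=> n; rewrite (le_trans (ler_norm _))//; near: n.
exact: (cvgr0_norm_le _ p0 _ h).
Unshelve. all: by end_near. Qed.

Let inv_sg_le n : (0 < n)%N -> p n <= 2^-1 -> (sg n)^-1 <= Num.sqrt (2 * (n%:R^-1 / p n)).
Proof.
move=> n0 p2; case/andP: (p01 n) => pp _.
have := @sqrt_div_std R n%:R (p n) 1 _ pp p2 ler01; rewrite ltr0n n0 => /(_ isT).
by rewrite sqrtr1 mul1r mulr1.
Qed.

Section clt.
Hypothesis np : much_less (fun n => n%:R^-1) p.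

Let inv_sg0 : (sg n)^-1 @[n --> \oo] --> (0 : R).
Proof.
have l : Num.sqrt (2 * (n%:R^-1 / p n)) @[n --> \oo] --> (0 : R).
  apply: sqrt_cvg0; rewrite -(mulr0 2); apply: cvgM; first exact: cvg_cst.
  exact: np.
apply: (squeeze_cvgr _ (cvg_cst 0) l); near=> n.
rewrite invr_ge0 sqrtr_ge0/= inv_sg_le//; near: n; last exact: near_half.
by exists 1%N.
Unshelve. all: by end_near. Qed.

Let near_sg1 : \forall n \near \oo, 1 <= sg n.
Proof.
near=> n.
have n0 : (0 < n)%N by near: n; exists 1%N.
have p2 : p n <= 2^-1 by near: n; exact: near_half.
have sg_gt0 : 0 < sg n.
  case/andP: (p01 n) => pp p1.
  by rewrite sqrtr_gt0 !mulr_gt0 ?ltr0n ?subr_gt0.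
rewrite -[leLHS]invr1 -[leRHS]invrK lef_pV2 ?posrE ?invr_gt0//.
rewrite (le_trans (ler_norm _))//; near: n.
exact: (cvgr0_norm_le _ inv_sg0 _ ltr01).
Unshelve. all: by end_near. Qed.

Lemma cdf_cvg_of_kolmogorov (m s D : nat -> R) x :
  (\forall n \near \oo, forall h, 0 < h ->
    `|mean (@cube_prob R n (p n)) (fun v => ((score (p n) v - m n) / s n <= x)%R%:R)
      - Phi x| <= h + 2 * D n / h) ->
  D n @[n --> \oo] --> (0 : R) ->
  cdf (standardize_RV (num_correct_RV (p n) (@eps n)) (m n) (s n)) x @[n --> \oo]
    --> normal_prob 0 1 [set` `]-oo, x]].
Proof.
move=> bound D0; rewrite -PhiE.
under eq_cvg => n do rewrite (cdf_standardize (p01' n) (eps_iid n)).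
apply: cvg_EFin; first by near=> n.
exact: cvg_of_kolmogorov bound D0.
Unshelve. all: by end_near. Qed.

(** From p <= (ln n - ln ln n) / n <= 2 / sqrt n comes n p^2 <= 4, so the excess
    is bounded in mean and disappears after division by the standard deviation. *)
Lemma clt_sparse : much_less p (fun n => (ln n%:R - ln (ln n%:R)) / n%:R) ->
  cvg_in_distribution
    (fun n => standardize_RV (num_correct_RV (p n) (@eps n))
        (n%:R * (1 - p n)) (sg n)) (normal_prob 0 1).
Proof.
move=> pb x _.
have lim : ((@stein_cst R + 8) + normal_peak 1 * 6) * (sg n)^-1 @[n --> \oo] --> (0 : R).
  rewrite -(mulr0 (stein_cst + 8 + normal_peak 1 * 6)).
  by apply: cvgM; [exact: cvg_cst|exact: inv_sg0].
apply: cdf_cvg_of_kolmogorov lim; near=> n => h h0.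
have n0 : (0 < n)%N by near: n; exists 1%N.
have sg1 : 1 <= sg n by near: n; exact: near_sg1.
apply: le_trans (kolmogorov_centered (p01' n) sg1 _ h0) _.
rewrite lerD2l ler_wpM2r ?invr_ge0 ?(ltW h0)// ler_wpM2l// [leRHS]mulrDl lerD2l.
rewrite -[leRHS]mulrA ler_wpM2l ?normal_peak_ge0// ler_wpM2r ?invr_ge0 ?sqrtr_ge0//.
have np2 : n%:R * p n ^+ 2 <= 4.
  have nR0 : 0 < n%:R :> R by rewrite ltr0n.
  have en : expR 1 <= n%:R :> R by near: n; exact: nbhs_infty_ger.
  have pbn : `|p n / ((ln n%:R - ln (ln n%:R)) / n%:R)| <= 1.
    by near: n; exact: (cvgr0_norm_le _ pb _ ltr01).
  have [b1 b2] := ln_sub_lnln_bounds en.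
  set b := _ - _ in b1 b2 pbn.
  case/andP: (p01 n) => pp p1.
  have b0 : 0 < b / n%:R by rewrite divr_gt0//; lra.
  have {}pbn : n%:R * p n <= 2 * Num.sqrt n%:R.
    apply: le_trans b2; rewrite mulrC -ler_pdivlMr//.
    by move: pbn; rewrite (gtr0_norm (divr_gt0 pp b0)) ler_pdivrMr// mul1r.
  rewrite -(ler_pM2l nR0) mulrA -expr2 -exprMn.
  have np0 : 0 <= n%:R * p n by rewrite ltW// mulr_gt0.
  have := ler_pM np0 np0 pbn pbn; rewrite -!expr2 [(2 * _) ^+ 2]exprMn sqr_sqrtr ?(ltW nR0)//.
  by lra.
by lra.
Unshelve. all: by end_near. Qed.

(** The variance of the excess is at most 6 n p^2 + 8; relative to n p q >= n p / 2
    this is at most 12 p + 16 / (n p), which tends to 0. *)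
Lemma clt_dense :
  cvg_in_distribution
    (fun n => let X := num_correct_RV (p n) (@eps n) in
       standardize_RV X (fine 'E_(P n)[X]) (Num.sqrt (fine 'V_(P n)[X])))
    (normal_prob 0 1).
Proof.
move=> x _ /=.
pose D n : R := (@stein_cst R + 8) * (sg n)^-1 + normal_peak 1 * (2 *
  Num.sqrt (12 * p n + 16 * (n%:R^-1 / p n))).
have lim : D n @[n --> \oo] --> (0 : R).
  have -> : (0 : R) = (stein_cst + 8) * 0 + normal_peak 1 * (2 * 0) by rewrite !mulr0 addr0.
  apply: cvgD; first by apply: cvgM; [exact: cvg_cst|exact: inv_sg0].
  apply: cvgM; first exact: cvg_cst.
  apply: cvgM; first exact: cvg_cst.
  apply: sqrt_cvg0; have -> : (0 : R) = 12 * 0 + 16 * 0 by rewrite !mulr0 addr0.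
  apply: cvgD; apply: cvgM; [exact: cvg_cst|exact: p0|exact: cvg_cst|exact: np].
apply: cdf_cvg_of_kolmogorov lim; near=> n => h h0.
have n0 : (0 < n)%N by near: n; exists 1%N.
have p2 : p n <= 2^-1 by near: n; exact: near_half.
have sg1 : 1 <= sg n by near: n; exact: near_sg1.
have score0 v : 0 <= @score R n (p n) v by exact: ler0n.
rewrite (expectation_outcome (p01' n) (eps_iid n) score0 (num_correct_outcome _ _)).
rewrite (variance_outcome (p01' n) (eps_iid n) score0 (num_correct_outcome _ _))/=.
apply: le_trans (kolmogorov_standardized (p01' n) sg1 _ h0) _.
rewrite lerD2l ler_wpM2r ?invr_ge0 ?(ltW h0)// ler_wpM2l// /D lerD2l.
rewrite ler_wpM2l ?normal_peak_ge0// ler_wpM2l//.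
case/andP: (p01 n) => pp p1.
have nR0 : 0 < n%:R :> R by rewrite ltr0n.
set a := fin_variance _ _; have a0 : 0 <= a by apply: fin_variance_ge0 => v; exact: cube_prob_ge0.
apply: le_trans (sqrt_div_std nR0 pp p2 a0) _.
have r0 : 0 <= n%:R^-1 / p n by rewrite divr_ge0 ?invr_ge0 ?ltW.
rewrite ler_sqrt; last by rewrite addr_ge0// mulr_ge0// ltW.
have := @fin_variance_excess R n _ (p01' n); rewrite -/a => /(ler_wpM2r r0) h1.
have e1 : n%:R * p n ^+ 2 * (n%:R^-1 / p n) = p n by field; rewrite !gt_eqF.
nra.
Unshelve. all: by end_near. Qed.

End clt.

Lemma weak_law : cvg_in_probability P
  (fun n w => num_correct_RV (p n) (@eps n) w / n%:R) 1.
Proof.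
move=> e e0.
pose A n (v : {ffun 'I_n -> bool}) := e < `|score (p n) v / n%:R - 1|.
have E n : P n [set w | e < `|num_correct_RV (p n) (@eps n) w / n%:R - 1|] =
    (mean (@cube_prob R n (p n)) (fun v => (A n v)%:R))%:E.
  rewrite -(prob_outcome (p01' n) (eps_iid n)); congr (P n _).
  by apply/seteqP; split => w /=; rewrite /A -num_correct_outcome.
under eq_cvg => n do rewrite E.
apply: cvg_EFin; first by near=> n.
have l : e^-1 * (p n + p n ^+ 2 + 2 * n%:R^-1) @[n --> \oo] --> (0 : R).
  have -> : (0 : R) = e^-1 * (0 + 0 ^+ 2 + 2 * 0) by rewrite expr0n !mulr0 !addr0 mulr0.
  apply: cvgM; first exact: cvg_cst.
  apply: cvgD; first by apply: cvgD => //; apply: cvgM.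
  by apply: cvgM; [exact: cvg_cst|rewrite -(cvg_shiftS (fun n => n%:R^-1 : R)); exact: cvg_harmonic].
apply: (squeeze_cvgr _ (cvg_cst 0) l); near=> n.
have n0 : 0 < n%:R :> R by rewrite ltr0n; near: n; exists 1%N.
rewrite mean_ge0/=; last 2 first.
- exact: cube_prob_ge0.
- by move=> v; exact: ler0n.
have en0 : 0 < e * n%:R by rewrite mulr_gt0.
apply: (@le_trans _ _ (mean (@cube_prob R n (p n)) (fun v => (e * n%:R)^-1 * `|score (p n) v - n%:R|))).
  apply: mean_le => v; first exact: cube_prob_ge0.
  rewrite /A; case: ltP => [ev|_] /=; last by rewrite mulr_ge0// invr_ge0 ltW.
  rewrite mulrC ler_pdivlMr// mul1r -ler_pdivlMr//.
  rewrite -[X in _ / X](gtr0_norm n0) -normf_div mulrBl divff ?gt_eqF//; exact: ltW.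
rewrite meanZ (le_trans (ler_wpM2l _ (@mean_norm_defect R n _ (p01' n))))//.
  by rewrite invr_ge0 ltW.
rewrite le_eqVlt; apply/orP; left; apply/eqP; field.
by rewrite !gt_eqF//.
Unshelve. all: by end_near. Qed.

(** ln n - ln ln n is at least 1 once n >= e. *)
Lemma inv_much_less :
  much_less (fun n => (ln n%:R - ln (ln n%:R)) / n%:R) p ->
  much_less (fun n => n%:R^-1) p.
Proof.
move=> bp; apply: (squeeze_cvgr _ (cvg_cst 0) bp); near=> n.
have n0 : (0 < n)%N by near: n; exists 1%N.
have en : expR 1 <= n%:R :> R by near: n; exact: nbhs_infty_ger.
have [b1 _] := ln_sub_lnln_bounds en.
case/andP: (p01 n) => pp _.
rewrite divr_ge0 ?invr_ge0 ?(ltW pp)//= ler_wpM2r ?invr_ge0 ?(ltW pp)//.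
by rewrite -[leLHS]mul1r ler_wpM2r ?invr_ge0.
Unshelve. all: by end_near. Qed.

End asymptotics.

Theorem theorem8 (R : realType) (p : nat -> R)
    (d : nat -> measure_display) (T : forall n, measurableType (d n))
    (P : forall n, probability (T n) R)
    (eps : forall n, 'I_n -> {RV (P n) >-> bool})
    (p01 : forall n, 0 < p n < 1)
    (p0 : p n @[n --> \oo] --> 0)
    (eps_iid : forall n, iid_bernoulli (p n) (eps n)) :
  let q n := 1 - p n in
  let b n := (ln n%:R - ln (ln n%:R)) / n%:R in
  let X n := num_correct_RV (p n) (eps n) in
  [/\ much_less (fun n => n%:R^-1) p -> much_less p b ->
        cvg_in_distribution
          (fun n => standardize_RV (X n)
             (n%:R * q n) (Num.sqrt (n%:R * p n * q n)))
          (normal_prob 0 1),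
      much_less p (fun n => n%:R^-1) ->
        cvg_in_probability P (fun n w => X n w / n%:R) 1
    & much_less b p ->
        cvg_in_distribution
          (fun n => standardize_RV (X n)
             (fine 'E_(P n)[X n]) (Num.sqrt (fine 'V_(P n)[X n])))
          (normal_prob 0 1)].
Proof.
move=> q b X; split.
- by move=> np pb; exact: clt_sparse.
- by move=> _; exact: weak_law.
- by move=> bp; exact: clt_dense (inv_much_less p01 bp).
Qed.
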